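(* Let $\alpha=(\alpha_1,\dots,\alpha_r)$ and $\beta=(\beta_1,\dots,\beta_s)$ be tuples of parameters in $\mathbb{Q}\setminus\mathbb{Z}_{\leq 0}$ such that $F_{\alpha,\beta}$ is $N$-integral. Then there exists $C\in\mathbb{N}$ such that $$ C_{\alpha,\beta}=C\,\frac{\prod_{i=1}^r d(\alpha_i)}{\prod_{j=1}^s d(\beta_j)}\prod_{p\in\mathcal{P}_{\alpha,\beta}} p^{-\left\lfloor\frac{\lambda_p(\alpha,\beta)}{p-1}\right\rfloor}. $$ Furthermore, if $r=s$ and all elements of $\alpha$ and $\beta$ lie in $(0,1]$, then $C=1$.
   Context: For tuples $\alpha=(\alpha_1,\dots,\alpha_r)$, $\beta=(\beta_1,\dots,\beta_s)$ of parameters in $\mathbb{Q}\setminus\mathbb{Z}_{\leq 0}$, the generalized hypergeometric series is $F_{\alpha,\beta}(z)=\sum_{n\geq 0}\frac{(\alpha_1)_n\cdots(\alpha_r)_n}{(\beta_1)_n\cdots(\beta_s)_n}z^n$, where $(x)_n=x(x+1)\cdots(x+n-1)$ for $n\ge1$ and $(x)_0=1$. A power series $f(z)\in\mathbb{C}[[z]]$ is $N$-integral if there is $c\in\mathbb{Q}$ with $f(cz)\in\mathbb{Z}[[z]]$. If $F_{\alpha,\beta}$ is $N$-integral, the set of all $c\in\mathbb{Q}$ with $F_{\alpha,\beta}(cz)\in\mathbb{Z}[[z]]$ is $C_{\alpha,\beta}\mathbb{Z}$ for some $C_{\alpha,\beta}\in\mathbb{Q}\setminus\{0\}$. For a rational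 $a$, $d(a)$ denotes its exact denominator. $d_{\alpha,\beta}$ is the least common multiple of the exact denominators of the elements of $\alpha$ and $\beta$. For a prime $p$, $\lambda_p(\alpha,\beta)=\#\{1\le i\le r:\alpha_i\in\mathbb{Z}_p\}-\#\{1\le j\le s:\beta_j\in\mathbb{Z}_p\}$, where $\mathbb{Z}_p$ is the ring of $p$-adic integers. $\mathcal{P}_{\alpha,\beta}$ is the set of primes $p$ such that $p$ divides $d_{\alpha,\beta}$ or $p\le r-s+1$. *)

(* Defs.v *)
From mathcomp Require Import all_boot all_order all_algebra.
From mathcomp Require Import zify.

Set Implicit Arguments.
Unset Strict Implicit.
Unset Printing Implicit Defensive.

Import Order.TTheory GRing.Theory Num.Theory.
Local Open Scope ring_scope.

(* A power series over the rationals is its sequence of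
   coefficients f : nat -> rat. *)

Definition is_param (x : rat) : bool := ~~ ((x \is a Num.int) && (x <= 0)).

Definition poch (x : rat) (n : nat) : rat := \prod_(k < n) (x + k%:R).

Definition hypergeom (alpha beta : seq rat) (n : nat) : rat :=
  (\prod_(a <- alpha) poch a n) / (\prod_(b <- beta) poch b n).

(* The coefficients of f(cz). *)
Definition rescale (c : rat) (f : nat -> rat) (n : nat) : rat := f n * c ^+ n.

Definition integral_series (f : nat -> rat) : Prop :=
  forall n, f n \is a Num.int.

(* c = 0 is excluded: f(0z) is the constant term of f, so it would make every
   series with f(0) = 1 N-integral. *)
Definition N_integral (f : nat -> rat) : Prop :=
  exists2 c : rat, c != 0 & integral_series (rescale c f).

(* The generator of the group of all c with f(cz) in Z[[z]] is only defined up
   to sign; the positive one is chosen. *)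
Definition is_eisenstein_const (f : nat -> rat) (C : rat) : Prop :=
  0 < C /\
  forall c : rat,
    integral_series (rescale c f) <-> exists k : int, c = C * k%:~R.

Lemma is_eisenstein_const_unique (f : nat -> rat) (C1 C2 : rat) :
  is_eisenstein_const f C1 -> is_eisenstein_const f C2 -> C1 = C2.
Proof.
have le_gen (C D : rat) :
  is_eisenstein_const f C -> is_eisenstein_const f D -> D <= C.
  move=> [C0 HC] [D0 HD].
  have [k Ck] : exists k : int, C = D * k%:~R.
    by apply/HD/HC; exists 1; rewrite mulr1.
  move: C0; rewrite Ck pmulr_rgt0 // ltr0z => k0.
  by rewrite ler_peMr ?(ltW D0) // ler1z -gtz0_ge1.
by move=> h1 h2; apply/le_anti; rewrite !le_gen.
Qed.

Definition exact_denom (x : rat) : nat := `|denq x|%N.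

Definition lcm_denom (alpha beta : seq rat) : nat :=
  \big[lcmn/1%N]_(x <- alpha ++ beta) exact_denom x.

(* The p-adic valuation, except that it is 0 instead of +oo at x = 0; this does
   not affect the sign condition defining in_Zp. *)
Definition padic_val (p : nat) (x : rat) : int :=
  (logn p `|numq x|%N)%:Z - (logn p (exact_denom x))%:Z.

(* The p-adic integers are the p-adic numbers of nonnegative valuation. *)
Definition in_Zp (p : nat) (x : rat) : bool := 0 <= padic_val p x.

Definition lambda (p : nat) (alpha beta : seq rat) : int :=
  (count (in_Zp p) alpha)%:Z - (count (in_Zp p) beta)%:Z.

(* p + s <= r + 1 is p <= r - s + 1 in the integers. *)
Definition exc_prime (alpha beta : seq rat) (p : nat) : bool :=
  prime p &&
  ((p %| lcm_denom alpha beta)%N || (p + size beta <= size alpha + 1)%N).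

(* A bound on the exceptional primes, used to enumerate them. *)
Definition exc_bound (alpha beta : seq rat) : nat :=
  (lcm_denom alpha beta + size alpha + 2)%N.

Lemma exc_prime_bound (alpha beta : seq rat) (p : nat) :
  exc_prime alpha beta p -> (p < exc_bound alpha beta)%N.
Proof.
have d0 : (0 < lcm_denom alpha beta)%N.
  rewrite /lcm_denom; elim/big_ind: _ => // [m n m0 n0|x _].
    by rewrite lcmn_gt0 m0.
  by rewrite absz_gt0 denq_neq0.
by rewrite /exc_bound => /andP[_ /orP[/(dvdn_leq d0)|]]; lia.
Qed.

Definition exc_primes (alpha beta : seq rat) : seq nat :=
  [seq p <- iota 0 (exc_bound alpha beta) | exc_prime alpha beta p].

Lemma mem_exc_primes (alpha beta : seq rat) (p : nat) :
  (p \in exc_primes alpha beta) = exc_prime alpha beta p.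
Proof.
rewrite mem_filter mem_iota andb_idr //; exact: exc_prime_bound.
Qed.

Lemma exc_primes_uniq (alpha beta : seq rat) : uniq (exc_primes alpha beta).
Proof. exact/filter_uniq/iota_uniq. Qed.

(* Main.v *)
(** For a prime p, f(cz) has p-integral coefficients iff v_p(c) exceeds some
    bound.  The valuation of (x)_n is -n v_p(d(x)) plus that of the numerators
    of x, ..., x+n-1; the latter is 0 if x is not in Z_p, and differs from
    n/(p-1) by O(1) at n = p^L otherwise.  Letting L grow bounds v_p(C_{a,b})
    from below by the exponent of the formula, so C is an integer.

    Now let r = s and all parameters be in (0,1], with common denominator d,
    and write x = u/d.  For a large prime p with pc = 1 mod d, the valuation of
    (x)_n is the number of j <= m = floor(nd/p) with j = cu mod d.  By
    Dirichlet's theorem every class c is reached, so N-integrality yields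
    Christol's criterion: for c coprime to d and all m, alpha yields at least
    as many such j as beta.  For an arbitrary prime p, sum these inequalities
    with m = floor(nd/p^l) over l >= 1 and over the units c mod d that are
    inverse to p^l modulo the p'-part of d.  The substitution i = p^l j turns a
    parameter in Z_p into v_p((x)_n) and makes the sum over l telescope to
    n/(p-1) for the other parameters, which is the upper bound for v_p(C_{a,b}).

    Dirichlet's theorem is proved without complex characters.  For a function f
    of mean 0 on the units mod d put L(f) = sum f(n)/n, and let f_m(n) = f(mn).
    If f |-> (m |-> L(f_m)) is injective it is onto, and then
    sum h(n) Lambda(n)/n is bounded for all h of mean 0, so the primes are
    equidistributed.  If f <> 0 is in the kernel, Moebius inversion gives
    sum c(n) Lambda(n)/n = - c(1) log x + O(1) for the autocorrelation c of f;
    as c + c(1) >= 0, almost all primes g then satisfy f_g = -f.  It follows that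
    f_g = f or f_g = -f for all units g, and the sign is a real character chi
    with L(chi) = 0.  This contradicts the lower bound that the squares give
    for sum (chi * 1)(n) (x - n). *)
Require Import Defs.
From mathcomp Require Import all_boot all_order all_algebra.
From mathcomp Require Import zify ring lra.
From mathcomp Require Import boolp classical_sets reals sequences exp Rstruct.

Set Implicit Arguments.
Unset Strict Implicit.
Unset Printing Implicit Defensive.

Import Order.TTheory GRing.Theory Num.Theory.
Local Open Scope ring_scope.

(** * Divisor sums, von Mangoldt and Moebius functions *)

Lemma sum_divisorsE (V : nmodType) (n : nat) (F : nat -> V) : (0 < n)%N ->
  \sum_(m <- divisors n) F m = \sum_(1 <= m < n.+1 | (m %| n)%N) F m.
Proof.
move=> n0; rewrite -[RHS]big_filter; apply: perm_big; apply: uniq_perm.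
- exact: divisors_uniq.
- exact/filter_uniq/iota_uniq.
move=> m; rewrite -dvdn_divisors // mem_filter mem_index_iota.
case: (boolP (m %| n)%N) => //= mn; by rewrite (dvdn_gt0 n0 mn) ltnS dvdn_leq.
Qed.

Lemma sum_divisors_swap (V : nmodType) (x : nat) (h : nat -> nat -> V) :
  \sum_(1 <= n < x.+1) \sum_(m <- divisors n) h m (n %/ m)%N =
  \sum_(1 <= m < x.+1) \sum_(1 <= k < (x %/ m).+1) h m k.
Proof.
elim: x => [|x IH]; first by rewrite !big_geq.
rewrite big_nat_recr //= IH [RHS]big_nat_recr //=.
rewrite divnn /= big_nat1 sum_divisorsE // [X in _ + X = _]big_mkcond /=.
rewrite [X in _ + X = _]big_nat_recr //= dvdnn divnn /= addrA; congr (_ + _).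
rewrite -big_split /=; apply: eq_big_nat => m /andP[m0 mx].
rewrite divnS //; case: ifP => mx1 /=; last by rewrite addr0.
by rewrite mx1 !add1n [in RHS]big_nat_recr.
Qed.

Lemma logn_pfactorM (p i m : nat) : prime p -> (0 < m)%N -> ~~ (p %| m)%N ->
  logn p (p ^ i * m)%N = i.
Proof.
move=> pp m0 pm; rewrite lognM ?expn_gt0 ?(prime_gt0 pp) // pfactorK //.
by rewrite lognE pp m0 (negbTE pm) addn0.
Qed.

Lemma sum_divisors_pfactor (V : nmodType) (p a n : nat) (g : nat -> V) :
  prime p -> (0 < n)%N -> ~~ (p %| n)%N ->
  \sum_(m <- divisors (p ^ a * n)) g m =
  \sum_(0 <= i < a.+1) \sum_(m <- divisors n) g (p ^ i * m)%N.
Proof.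
move=> pp n0 pn; have p0 := prime_gt0 pp.
have pa0 : (0 < p ^ a)%N by rewrite expn_gt0 p0.
have cop : coprime (p ^ a) n by rewrite coprimeXl // prime_coprime.
pose f i m := (p ^ i * m)%N.
have -> : \sum_(0 <= i < a.+1) \sum_(m <- divisors n) g (p ^ i * m)%N =
    \sum_(m <- [seq f i m | i <- index_iota 0 a.+1, m <- divisors n]) g m.
  by rewrite big_allpairs_dep.
apply: perm_big; apply: uniq_perm; first exact: divisors_uniq.
  apply: allpairs_uniq; [exact: iota_uniq|exact: divisors_uniq|].
  move=> [i m] [j k] /allpairsP[[i' m'] [_ m'n [-> ->]]].
  move=> /allpairsP[[j' k'] [_ k'n [-> ->]]].
  rewrite /= -!dvdn_divisors // in m'n k'n *; rewrite /f => eq_ik.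
  have m'0 := dvdn_gt0 n0 m'n; have k'0 := dvdn_gt0 n0 k'n.
  have pm' : ~~ (p %| m')%N by apply: contra pn => /dvdn_trans; apply.
  have pk' : ~~ (p %| k')%N by apply: contra pn => /dvdn_trans; apply.
  have eij : i' = j'.
    by rewrite -(logn_pfactorM i' pp m'0 pm') eq_ik logn_pfactorM.
  move: eq_ik; rewrite eij => /eqP; rewrite eqn_pmul2l ?expn_gt0 ?p0 //.
  by move=> /eqP ->.
move=> m; rewrite -dvdn_divisors ?muln_gt0 ?pa0 //.
apply/idP/allpairsP => [mn|[[i k] [+ + ->]]].
  have m0 : (0 < m)%N by apply: dvdn_gt0 mn; rewrite muln_gt0 pa0.
  have [k pk mE] := pfactor_coprime pp m0.
  have pk' : ~~ (p %| k)%N by rewrite -prime_coprime.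
  have [k0 km] : (0 < k)%N /\ (k %| m)%N.
    by move: m0; rewrite mE muln_gt0 => /andP[-> _]; rewrite dvdn_mulr.
  exists (logn p m, k); split.
  - change (logn p m \in index_iota 0 a.+1).
    rewrite mem_index_iota ltnS; rewrite -(logn_pfactorM a pp n0 pn).
    by apply: dvdn_leq_log; rewrite // muln_gt0 pa0.
  - rewrite -[_.2]/k -dvdn_divisors // -(@Gauss_dvdr _ (p ^ a)) ?(dvdn_trans km) //.
    by rewrite coprime_sym coprimeXl.
  - by rewrite /f mulnC.
change (i \in index_iota 0 a.+1 -> k \in divisors n -> (f i k %| p ^ a * n)%N).
rewrite mem_index_iota -dvdn_divisors // ltnS => ia kn.
by rewrite /f dvdn_mul // dvdn_exp2l.
Qed.

Lemma prime_factor_ind (P : nat -> Prop) : P 1%N ->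
  (forall p a n, prime p -> (0 < n)%N -> ~~ (p %| n)%N -> P n ->
     P (p ^ a.+1 * n)%N) ->
  forall n, (0 < n)%N -> P n.
Proof.
move=> P1 Pp; elim/ltn_ind => n IH n0.
have [->//|n1] := eqVneq n 1%N.
have ngt1 : (1 < n)%N by rewrite ltn_neqAle eq_sym n1.
have pp := pdiv_prime ngt1; set p := pdiv n in pp *.
have [k pk nE] := pfactor_coprime pp n0.
have k0 : (0 < k)%N by move: n0; rewrite nE muln_gt0 => /andP[].
have l0 : (0 < logn p n)%N by rewrite logn_gt0 mem_primes pp n0 pdiv_dvd.
rewrite nE mulnC -(prednK l0); apply: Pp => //; first by rewrite -prime_coprime.
apply: IH => //; rewrite [ltnRHS]nE -[ltnLHS]muln1 ltn_pmul2l //.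
by rewrite -(exp1n (logn p n)) ltn_exp2r // prime_gt1.
Qed.

Section Arithmetic.
Variable R : realType.

(* [n = 1] passes the test too, with the right value [ln 1 = 0]. *)
Definition mangoldt (n : nat) : R :=
  if n == (pdiv n ^ logn (pdiv n) n)%N then ln (pdiv n)%:R else 0.

Definition moebius (n : nat) : R :=
  if all (fun p => logn p n == 1%N) (primes n) then (-1) ^+ size (primes n)
  else 0.

Lemma mangoldt_ge0 n : 0 <= mangoldt n.
Proof.
rewrite /mangoldt; case: ifP => // _; have := pdiv_gt0 n.
by move=> h; rewrite ln_ge0 // ler1n.
Qed.

Lemma mangoldt_pX p i : prime p -> mangoldt (p ^ i.+1) = ln p%:R.
Proof. by move=> pp; rewrite /mangoldt pdiv_pfactor // pfactorK // eqxx. Qed.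

Lemma mangoldt_pfactorM p i m : prime p -> (1 < m)%N -> ~~ (p %| m)%N ->
  mangoldt (p ^ i.+1 * m) = 0.
Proof.
move=> pp m1 pm; rewrite /mangoldt; case: eqP => // e.
have n1 : (1 < p ^ i.+1 * m)%N.
  by rewrite (leq_trans m1) // leq_pmull // expn_gt0 prime_gt0.
have qp := pdiv_prime n1; set q := pdiv _ in e qp.
have div_eq r : prime r -> (r %| p ^ i.+1 * m)%N -> r = q.
  by move=> rp; rewrite e Euclid_dvdX // => /andP[]; rewrite dvdn_prime2 // => /eqP.
have pq : p = q by apply: div_eq => //; rewrite expnS -mulnA dvdn_mulr.
have mq : pdiv m = q.
  by apply: div_eq; [exact: pdiv_prime|rewrite dvdn_mull // pdiv_dvd].
by move: pm; rewrite pq -mq pdiv_dvd.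
Qed.

Lemma mangoldt1 : mangoldt 1 = 0.
Proof. by rewrite /mangoldt /= ln1. Qed.

Lemma sum_mangoldt n : (0 < n)%N ->
  \sum_(m <- divisors n) mangoldt m = ln n%:R.
Proof.
move: n; apply: prime_factor_ind => [|p a n pp n0 pn IH].
  by rewrite big_seq1 mangoldt1 ln1.
have p0 := prime_gt0 pp.
rewrite sum_divisors_pfactor // big_nat_recl //=.
under eq_bigr => m _ do rewrite mul1n.
rewrite IH natrM lnM ?posrE ?ltr0n ?expn_gt0 ?p0 // addrC; congr (_ + _).
rewrite natrX lnXn ?ltr0n //.
rewrite (eq_bigr (fun=> ln p%:R)) ?sumr_const_nat ?subn0 // => i _.
rewrite (big_rem 1%N) /=; last by rewrite divisor1.
rewrite muln1 mangoldt_pX // big_seq big1 ?addr0 // => m.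
rewrite mem_rem_uniq ?divisors_uniq // inE -dvdn_divisors // => /andP[m1 mn].
apply: mangoldt_pfactorM => //.
  by rewrite ltn_neqAle eq_sym m1 (dvdn_gt0 n0 mn).
by apply: contra pn => /dvdn_trans; apply.
Qed.

Lemma moebius_norm n : `|moebius n| <= 1.
Proof.
by rewrite /moebius; case: ifP; rewrite ?normr0 ?ler01 // normrX normrN1 expr1n.
Qed.

Lemma moebius_pfactorM p i m : prime p -> (0 < m)%N -> ~~ (p %| m)%N ->
  moebius (p ^ i.+1 * m) = if i is 0%N then - moebius m else 0.
Proof.
move=> pp m0 pm.
have pr : perm_eq (primes (p ^ i.+1 * m)) (p :: primes m).
  apply: uniq_perm; first exact: primes_uniq.
    by rewrite /= primes_uniq mem_primes pp m0 (negbTE pm).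
  move=> q; rewrite primesM ?expn_gt0 ?(prime_gt0 pp) // primesX // primes_prime //.
  by rewrite inE in_cons.
have lE : {in primes m, (fun q => logn q (p ^ i.+1 * m) == 1%N) =1
                        (fun q => logn q m == 1%N)}.
  move=> q qm /=; rewrite lognM ?expn_gt0 ?(prime_gt0 pp) // lognX logn_prime //.
  have /negbTE-> : q != p; last by rewrite muln0.
  by apply: contraTneq qm => ->; rewrite mem_primes (negbTE pm) !andbF.
rewrite /moebius (perm_size pr) (perm_all _ pr) /= logn_pfactorM //.
rewrite (eq_in_all lE).
case: i {pr lE} => [|i] //=.
by rewrite exprS mulN1r; case: ifP; rewrite ?oppr0.
Qed.

Lemma sum_moebius_mul p a n (g : nat -> R) :
  prime p -> (0 < n)%N -> ~~ (p %| n)%N ->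
  \sum_(m <- divisors (p ^ a.+1 * n)) moebius m * g m =
  \sum_(m <- divisors n) moebius m * (g m - g (p * m)%N).
Proof.
move=> pp n0 pn; rewrite sum_divisors_pfactor // big_nat_recl // big_nat_recl //=.
have mE i : \sum_(m <- divisors n) moebius (p ^ i.+1 * m) * g (p ^ i.+1 * m)%N =
   \sum_(m <- divisors n) (if i is 0%N then - moebius m else 0) * g (p ^ i.+1 * m)%N.
  apply: eq_big_seq => m; rewrite -dvdn_divisors // => mn.
  rewrite moebius_pfactorM ?(dvdn_gt0 n0 mn) //.
  by apply: contra pn => /dvdn_trans; apply.
rewrite [X in _ + (_ + X)]big1 ?addr0 => [|i _]; last first.
  by rewrite mE; apply: big1 => m _; rewrite mul0r.
rewrite mE -big_split /=; apply: eq_bigr => m _.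
by rewrite mul1n expn1 mulrBr mulNr.
Qed.

Lemma sum_moebius n : (0 < n)%N ->
  \sum_(m <- divisors n) moebius m = (n == 1%N)%:R.
Proof.
move: n; apply: prime_factor_ind => [|p a n pp n0 pn _].
  by rewrite big_seq1 /moebius.
rewrite (eq_bigr (fun m => moebius m * (fun=> 1) m)) => [|m _]; last by rewrite mulr1.
rewrite sum_moebius_mul // big1 => [|m _]; last by rewrite subrr mulr0.
rewrite gtn_eqF // (leq_trans (prime_gt1 pp)) // expnS -mulnA leq_pmulr //.
by rewrite muln_gt0 expn_gt0 prime_gt0.
Qed.

Lemma sum_moebius_ln n : (0 < n)%N ->
  \sum_(m <- divisors n) moebius m * ln m%:R = - mangoldt n.
Proof.
move: n; apply: prime_factor_ind => [|p a n pp n0 pn _].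
  by rewrite big_seq1 ln1 mulr0 mangoldt1 oppr0.
rewrite (sum_moebius_mul _ (fun m => ln m%:R)) //.
rewrite (eq_big_seq (fun m => moebius m * - ln p%:R)) => [|m]; last first.
  rewrite -dvdn_divisors // => /(dvdn_gt0 n0) m0.
  by rewrite natrM lnM ?posrE ?ltr0n ?(prime_gt0 pp) // opprD addrCA subrr addr0.
rewrite -mulr_suml sum_moebius //; case: eqVneq => [->|n1].
  by rewrite muln1 mangoldt_pX // mul1r.
by rewrite mangoldt_pfactorM ?mul0r ?oppr0 // ltn_neqAle eq_sym n1.
Qed.

Lemma sum_moebius_ln_div x n : (0 < x)%N -> (0 < n)%N ->
  \sum_(m <- divisors n) moebius m * ln (x%:R / m%:R) =
  (n == 1%N)%:R * ln x%:R + mangoldt n.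
Proof.
move=> x0 n0; rewrite -[mangoldt n]opprK -sum_moebius_ln // -sum_moebius //.
rewrite mulr_suml -sumrB; apply: eq_big_seq => m; rewrite -dvdn_divisors //.
by move=> /(dvdn_gt0 n0) m0; rewrite ln_div ?posrE ?ltr0n // mulrBr.
Qed.

End Arithmetic.

(** * Estimates of Chebyshev and Mertens *)

Section Mertens.
Variable R : realType.
Local Notation mangoldt := (@mangoldt R).

Lemma ln_succ_sub n : (0 < n)%N -> ln n.+1%:R - ln n%:R <= n%:R^-1 :> R.
Proof.
move=> n0; rewrite -ln_div ?posrE ?ltr0n //.
have -> : n.+1%:R / n%:R = 1 + n%:R^-1 :> R.
  by rewrite -natr1 mulrDl divff ?pnatr_eq0 -?lt0n // mul1r.
by apply: le_ln1Dx; apply: (@lt_le_trans _ _ 0); rewrite ?ltrN10 ?invr_ge0.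
Qed.

Lemma ln_fact_mangoldt n :
  \sum_(1 <= m < n.+1) mangoldt m * (n %/ m)%:R = ln (n`!)%:R.
Proof.
transitivity (\sum_(1 <= k < n.+1) ln k%:R : R).
  transitivity (\sum_(1 <= k < n.+1) \sum_(m <- divisors k) mangoldt m).
    rewrite (sum_divisors_swap _ (fun m _ => mangoldt m)).
    apply: eq_big_nat => m _.
    by rewrite sumr_const_nat subSS subn0 mulr_natr.
  by apply: eq_big_nat => k /andP[k0 _]; rewrite sum_mangoldt.
elim: n => [|n IH]; first by rewrite big_geq // fact0 ln1.
rewrite big_nat_recr //= IH factS natrM lnM ?posrE ?ltr0n ?fact_gt0 //.
exact: addrC.
Qed.

Lemma ln_fact_ge n : n%:R * ln n%:R - n%:R <= ln (n`!)%:R :> R.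
Proof.
elim: n => [|n IH]; first by rewrite mul0r subr0 fact0 ln1.
rewrite factS natrM lnM ?posrE ?ltr0n ?fact_gt0 //.
have [->|n0] := posnP n; first by rewrite fact0 !ln1 mulr0 addr0 sub0r oppr_le0 ler0n.
have := ln_succ_sub n0.
have np : 0 < n%:R :> R by rewrite ltr0n.
rewrite -(ler_pM2l np) divff ?gt_eqF // => h.
move: h; set L := ln n.+1%:R; rewrite -natr1; lra.
Qed.

Lemma fact_le_sqr_half n : (n`! <= 4 ^ n * (n./2)`! ^ 2)%N.
Proof.
set h := n./2.
have hn : (h <= n)%N by rewrite /h; lia.
rewrite -(bin_fact hn).
have b2 : ('C(n, h) <= 2 ^ n)%N.
  rewrite -[X in (X ^ n)%N]/(1 + 1)%N expnDn (bigD1 (inord h)) //=.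
  by rewrite inordK ?ltnS // !exp1n !muln1 leq_addr.
have f2 : ((n - h)`! <= 2 ^ n * h`!)%N.
  apply: (@leq_trans (h.+1)`!).
    by apply: leq_fact; rewrite /h; lia.
  rewrite factS leq_mul2r (leq_trans (ltn_expl h (ltnSn 1))) ?orbT //.
  by rewrite leq_exp2l.
have -> : (4 ^ n = 2 ^ n * 2 ^ n)%N by rewrite -expnMn.
have := leq_mul b2 (leq_mul (leqnn h`!) f2).
by move=> /leq_trans; apply; rewrite expnS expn1; lia.
Qed.

Definition chebyshev_psi n : R := \sum_(1 <= m < n.+1) mangoldt m.

Lemma psi_half n : chebyshev_psi n <= chebyshev_psi n./2 + 2 * n%:R.
Proof.
set h := n./2.
have hn : (h <= n)%N by rewrite /h; lia.
have lnfh : ln (h`!)%:R = \sum_(1 <= m < n.+1) mangoldt m * (h %/ m)%:R.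
  rewrite -ln_fact_mangoldt [RHS](@big_cat_nat _ _ _ h.+1) //=.
  rewrite [X in _ + X]big_nat_cond [X in _ + X]big1 ?addr0 //.
  by move=> m /andP[/andP[hm _] _]; rewrite divn_small ?mulr0.
have le1 : chebyshev_psi n - chebyshev_psi h <= ln (n`!)%:R - 2 * ln (h`!)%:R.
  rewrite lnfh -ln_fact_mangoldt mulr_sumr -sumrB.
  rewrite /chebyshev_psi (@big_cat_nat _ _ _ h.+1) //= addrAC subrr add0r.
  rewrite [leRHS](@big_cat_nat _ _ _ h.+1) //= -[leLHS]add0r lerD //.
    rewrite big_nat_cond; apply: sumr_ge0 => m /andP[/andP[m0 mh] _].
    rewrite mulrCA -mulrBr mulr_ge0 ?mangoldt_ge0 // subr_ge0 -natrM ler_nat.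
    by rewrite leq_divRL // /h; have := leq_trunc_div n./2 m; lia.
  rewrite big_nat_cond [leRHS]big_nat_cond; apply: ler_sum => m.
  move=> /andP[/andP[hm mn] _]; rewrite [(h %/ m)%N]divn_small // !mulr0 subr0.
  rewrite ler_peMr ?mangoldt_ge0 // ler1n divn_gt0; lia.
have le2 : ln (n`!)%:R - 2 * ln (h`!)%:R <= 2 * n%:R :> R.
  have f0 k : 0 < (k`!)%:R :> R by rewrite ltr0n fact_gt0.
  have : ln (n`!)%:R <= ln (4%:R ^+ n * (h`!)%:R ^+ 2) :> R.
    rewrite ler_ln ?posrE ?mulr_gt0 ?exprn_gt0 //.
    by rewrite -!natrX -natrM ler_nat fact_le_sqr_half.
  rewrite lnM ?posrE ?exprn_gt0 //.
  rewrite !lnXn //.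
  have l4 : ln 4%:R <= 2 :> R.
    have -> : 4%:R = (1 + 1) ^+ 2 :> R by ring.
    rewrite lnXn; last by lra.
    have := @le_ln1Dx R 1 (lt_trans (ltrN10 R) ltr01); lra.
  rewrite -[ln 4%:R *+ n]mulr_natr -[_ *+ 2]mulr_natr.
  have : ln 4%:R * n%:R <= 2 * n%:R :> R by rewrite ler_wpM2r.
  by move=> h1 h2; lra.
lra.
Qed.

Lemma psi_le n : chebyshev_psi n <= 4 * n%:R.
Proof.
elim/ltn_ind: n => n IH.
have [->|n0] := posnP n; first by rewrite /chebyshev_psi big_geq // mulr0.
have hn : (n./2 < n)%N by lia.
have := psi_half n; have := IH _ hn.
have : n./2%:R * 2 <= n%:R :> R by rewrite -natrM ler_nat; lia.
lra.
Qed.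

Lemma natr_div_ge (x m : nat) : (0 < m)%N -> (x %/ m)%:R <= x%:R / m%:R :> R.
Proof. by move=> m0; rewrite ler_pdivlMr ?ltr0n // -natrM ler_nat leq_trunc_div. Qed.

Lemma natr_div_lt (x m : nat) : (0 < m)%N -> x%:R / m%:R < (x %/ m).+1%:R :> R.
Proof. by move=> m0; rewrite ltr_pdivrMr ?ltr0n // -natrM ltr_nat ltn_ceil. Qed.

Lemma mertens_le x : (0 < x)%N ->
  \sum_(1 <= m < x.+1) mangoldt m / m%:R <= ln x%:R + 4.
Proof.
move=> x0; have xp : 0 < x%:R :> R by rewrite ltr0n.
rewrite -(ler_pM2l xp) mulr_sumr.
apply: (@le_trans _ _ (ln (x`!)%:R + chebyshev_psi x)).
  rewrite -ln_fact_mangoldt -big_split /=.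
  rewrite big_nat_cond [leRHS]big_nat_cond; apply: ler_sum => m.
  move=> /andP[/andP[m0 _] _].
  rewrite mulrCA -[X in _ + X]mulr1 -mulrDr ler_wpM2l ?mangoldt_ge0 //.
  by rewrite natr1 ltW // natr_div_lt.
have -> : x%:R * (ln x%:R + 4) = ln x%:R *+ x + 4 * x%:R :> R.
  by rewrite mulrDr mulr_natl [_ * 4]mulrC.
rewrite lerD ?psi_le // -lnXn // ler_ln ?posrE ?exprn_gt0 ?ltr0n ?fact_gt0 //.
rewrite -natrX ler_nat.
have le_fact n : (n <= x)%N -> (n`! <= x ^ n)%N.
  elim: n => [|n IH nx]; first by rewrite fact0 expn0.
  by rewrite factS expnS leq_mul // IH // ltnW.
exact: le_fact.
Qed.

Lemma mertens_ge x : (0 < x)%N ->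
  ln x%:R - 1 <= \sum_(1 <= m < x.+1) mangoldt m / m%:R.
Proof.
move=> x0; have xp : 0 < x%:R :> R by rewrite ltr0n.
rewrite -(ler_pM2l xp) mulr_sumr mulrBr mulr1.
apply: le_trans (ln_fact_ge x) _; rewrite -ln_fact_mangoldt.
rewrite big_nat_cond [leRHS]big_nat_cond; apply: ler_sum => m.
move=> /andP[/andP[m0 _] _].
by rewrite mulrCA ler_wpM2l ?mangoldt_ge0 // natr_div_ge.
Qed.

(* The terms are bounded by the decrements of [(ln n + 2) / n]. *)
Lemma ln_sqr_sum x : \sum_(2 <= n < x.+2) ln n%:R / n%:R ^+ 2 <=
   2 - (ln x.+1%:R + 2) / x.+1%:R :> R.
Proof.
elim: x => [|x IH]; first by rewrite big_geq // ln1 add0r divr1 subrr.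
rewrite big_nat_recr //=.
have n0 : (0 < x.+1)%N by [].
move: (ln_succ_sub n0) IH; set S := \sum_(_ <= _ < _) _.
have := ltr0Sn R x; rewrite -[x.+2%:R]natr1; set t := x.+1%:R.
have t1 : 1 <= t by rewrite ler1n.
have := @ln_ge0 _ (t + 1); set a := ln (t + 1); set b := ln t => a0 t0 ab IH.
have {}a0 : 0 <= a by apply: a0; lra.
clearbody a b S t; have key : a / (t + 1) ^+ 2 + (a + 2) / (t + 1) <= (b + 2) / t; last first.
  by move: key IH; set u := _ / _ ^+ 2; set v := _ / (t + 1); set w := _ / t; lra.

apply: (@le_trans _ _ ((a - t^-1 + 2) / t)); last first.
  by rewrite ler_pM2r ?invr_gt0 //; lra.
rewrite -subr_ge0.
have -> : (a - t^-1 + 2) / t - (a / (t + 1) ^+ 2 + (a + 2) / (t + 1)) =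
   (a * t + (t - 1) * (t + 1)) / (t ^+ 2 * (t + 1) ^+ 2).
  field; lra.
apply: divr_ge0; last by rewrite mulr_ge0 ?sqr_ge0.
by rewrite addr_ge0 // mulr_ge0; lra.
Qed.

Lemma geometric_tail (q : R) K : 2 <= q -> \sum_(2 <= k < K) q ^- k <= 2 / q ^+ 2.
Proof.
move=> q2; have q0 : 0 < q by lra.
have qi : q^-1 <= 1 / 2 by rewrite ler_pdivlMr // -ler_pdivlMl ?invr_gt0 ?invrK; lra.
suff h K' : \sum_(2 <= k < K'.+2) q ^- k <= 2 / q ^+ 2 - 2 * q ^- K'.+2.
  case: K => [|[|K]]; [by rewrite big_geq ?divr_ge0 ?sqr_ge0..|].
  by apply: le_trans (h K) _; rewrite gerBl mulr_ge0 // invr_ge0 exprn_ge0 // ltW.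
elim: K' => [|k IH]; first by rewrite big_geq // subrr.
rewrite big_nat_recr //=.
have : q ^- k.+3 <= q ^- k.+2 * (1 / 2).
  by rewrite exprSr invfM ler_wpM2l // invr_ge0 exprn_ge0 // ltW.
by move: IH; set s := \sum_(_ <= _ < _) _; lra.
Qed.

(* Only the powers [p ^ k] with [k >= 2] contribute. *)
Lemma mangoldt_nonprime x :
  \sum_(1 <= n < x.+1 | ~~ prime n) mangoldt n / n%:R <= 4.
Proof.
pose T p k : R := ln p%:R / (p ^ k)%:R.
have T0 p k : (1 < p)%N -> 0 <= T p k.
  by move=> p1; rewrite divr_ge0 // ln_ge0 // ler1n ltnW.
apply: (@le_trans _ _ (\sum_(1 <= n < x.+1)
   \sum_(2 <= p < x.+2) \sum_(2 <= k < x.+2) (n == p ^ k)%N%:R * T p k)).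
  rewrite [leRHS]big_nat_cond big_mkcond big_nat_cond; apply: ler_sum => n.
  move=> /andP[/andP[n0 nx] _].
  have rhs0 (r : seq nat) (P : pred nat) : \sum_(p <- r | P p && (1 < p)%N)
      \sum_(2 <= k < x.+2) (n == p ^ k)%N%:R * T p k >= 0.
    apply: sumr_ge0 => p /andP[_ p1].
    by apply: sumr_ge0 => k _; rewrite mulr_ge0 ?T0.
  have rhs : 0 <= \sum_(2 <= p < x.+2) \sum_(2 <= k < x.+2) (n == p ^ k)%N%:R * T p k.
    rewrite big_nat_cond; apply: sumr_ge0 => p /andP[/andP[p1 _] _].
    by apply: sumr_ge0 => k _; rewrite mulr_ge0 ?T0.
  case: ifP => // npn; rewrite {1}/mangoldt; case: eqP => [nE|_]; last by rewrite mul0r.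
  have [n1|n1] := leqP n 1.
    have -> : n = 1%N by apply/eqP; rewrite eqn_leq n1.
    by rewrite [pdiv 1]/= ln1 mul0r; move: rhs; have <- : n = 1%N by apply/eqP;
      rewrite eqn_leq n1.
  have pp := pdiv_prime n1; set p := pdiv n in nE pp *; set k := logn p n in nE.
  have p1 := prime_gt1 pp.
  have k2 : (1 < k)%N.
    case: k nE => [|[|//]] nE; first by rewrite nE in n1.
    by move: npn; rewrite nE expn1 pp.
  have pn : (p <= n)%N by rewrite pdiv_leq.
  have kn : (k <= n)%N by rewrite nE ltnW // ltn_expl.
  rewrite (big_rem p) /=; last by rewrite mem_index_iota p1; lia.
  rewrite (big_rem k) /=; last by rewrite mem_index_iota k2; lia.
  rewrite -nE eqxx mul1r /T -nE -addrA lerDl addr_ge0 //.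
    by apply: sumr_ge0 => j _; rewrite mulr_ge0 ?T0.
  rewrite big_seq_cond; apply: sumr_ge0 => r /andP[rr _].
  have : (1 < r)%N by move/mem_rem: rr; rewrite mem_index_iota => /andP[].
  by move=> r1; apply: sumr_ge0 => j _; rewrite mulr_ge0 ?T0.
rewrite exchange_big_nat /=.
apply: (@le_trans _ _ (\sum_(2 <= p < x.+2) 2 * (ln p%:R / p%:R ^+ 2))); last first.
  rewrite -mulr_sumr; apply: le_trans (ler_wpM2l _ (ln_sqr_sum x)) _ => //.
  have : 0 <= (ln x.+1%:R + 2) / x.+1%:R :> R.
    by rewrite divr_ge0 // addr_ge0 // ln_ge0 // ler1n.
  by move: (_ / _) => u u0; lra.
rewrite big_nat_cond [leRHS]big_nat_cond; apply: ler_sum => p /andP[/andP[p1 _] _].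
rewrite exchange_big_nat /=.
apply: (@le_trans _ _ (\sum_(2 <= k < x.+2) T p k)).
  apply: ler_sum => k _; rewrite -mulr_suml ler_piMl ?T0 //.
  have [pk|pk] := boolP ((p ^ k)%N \in index_iota 1 x.+1); last first.
    rewrite big_seq big1 // => n nx; case: eqP => // nE.
    by rewrite nE (negbTE pk) in nx.
  rewrite (big_rem _ pk) /= eqxx big_seq big1 ?addr0 // => n.
  by rewrite mem_rem_uniq ?iota_uniq // inE => /andP[/negbTE-> _].
rewrite -mulr_sumr mulrCA ler_wpM2l //; first by rewrite ln_ge0 // ler1n ltnW.
under eq_bigr => k _ do rewrite natrX.
by apply: geometric_tail; rewrite ler_nat.
Qed.

End Mertens.

(** * Abel summation *)

Section Abel.
Variable R : realType.
Implicit Types (f w : nat -> R) (D : R).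

Definition bounded_sums D f := forall i j, `|\sum_(i <= n < j) f n| <= D.

Lemma abel_bound D f w i j : bounded_sums D f ->
  (forall n, (i <= n)%N -> 0 <= w n) ->
  (forall n, (i <= n)%N -> w n.+1 <= w n) ->
  `|\sum_(i <= n < j) f n * w n| <= D * w i.
Proof.
move=> bf w0 wS.
have D0 : 0 <= D by apply: le_trans (bf 0 0).
have [ji|/ltnW ij] := leqP j i; first by rewrite big_geq // normr0 mulr_ge0 // w0.
pose A n := \sum_(i <= m < n) f m.
suff [-> bd] : \sum_(i <= n < j) f n * w n =
    A j * w j + \sum_(i <= n < j) A n.+1 * (w n - w n.+1) /\
    \sum_(i <= n < j) `|A n.+1 * (w n - w n.+1)| <= D * (w i - w j).
  apply: le_trans (ler_normD _ _) _.
  apply: (@le_trans _ _ (D * w j + D * (w i - w j))); last by rewrite -mulrDr addrC subrK.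
  rewrite lerD // ?normrM ?(ger0_norm (w0 _ ij)) ?ler_wpM2r ?w0 ?bf //.
  exact: le_trans (ler_norm_sum _ _ _) bd.
elim: j ij => [|j IH]; first by rewrite leqn0 => /eqP->;
  rewrite /A !big_geq // mul0r addr0 subrr mulr0.
rewrite leq_eqVlt => /predU1P[<-|].
  by rewrite /A !big_geq // mul0r addr0 subrr mulr0.
rewrite ltnS => ij; have [IH1 IH2] := IH ij.
rewrite !big_nat_recr //= IH1 /A !big_nat_recr //= -/(A j); split; first ring.
have -> : D * (w i - w j.+1) = D * (w i - w j) + D * (w j - w j.+1) by ring.
have wj : 0 <= w j - w j.+1 by rewrite subr_ge0 wS.
rewrite lerD // normrM (ger0_norm wj) ler_wpM2r //.
by have := bf i j.+1; rewrite big_nat_recr.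
Qed.

Definition hsum f x := \sum_(1 <= n < x.+1) f n / n%:R.

Definition hlim f l := exists D, forall x, `|hsum f x - l| <= D / x.+1%:R.

Lemma hsum_cauchy D f x y : bounded_sums D f -> (x <= y)%N ->
  `|hsum f y - hsum f x| <= D / x.+1%:R.
Proof.
move=> bf xy; rewrite /hsum (@big_cat_nat _ _ _ x.+1) //= addrAC subrr add0r.
by apply: abel_bound => // n xn; rewrite ?invr_ge0 // lef_pV2 ?posrE ?ltr0n ?ler_nat //; lia.
Qed.

Lemma hlim_exists D f : bounded_sums D f ->
  exists l, forall x, `|hsum f x - l| <= D / x.+1%:R.
Proof.
move=> bf; have D0 : 0 <= D by apply: le_trans (bf 0 0).
have Dn n m : (m <= n)%N -> D / n.+1%:R <= D / m.+1%:R.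
  by move=> mn; rewrite ler_wpM2l // lef_pV2 ?posrE ?ltr0n // ler_nat ltnS.
have Dp n : 0 <= D / n.+1%:R by rewrite divr_ge0.
have le_xy x y : hsum f x - D / x.+1%:R <= hsum f y + D / y.+1%:R.
  have [xy|/ltnW yx] := leqP x y.
    have := hsum_cauchy bf xy; rewrite ler_norml => /andP[]; move: (Dp y).
    by move: (D / _) (D / _) => u v; lra.
  have := hsum_cauchy bf yx; rewrite ler_norml => /andP[]; move: (Dp x).
  by move: (D / _) (D / _) => u v; lra.
pose E : set R := [set z | exists x, z = hsum f x - D / x.+1%:R]%classic.
exists (sup E) => x; rewrite distrC ler_norml.
have supE : has_sup E.
  split; first by exists (hsum f 0 - D / 1%:R), 0%N.
  by exists (hsum f 0 + D / 1%:R) => z [y ->]; exact: le_xy.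
apply/andP; split.
  by rewrite lerBrDl; apply: (ub_le_sup supE.2); exists x.
rewrite lerBlDl; apply: (ge_sup supE.1) => z [y ->]; exact: le_xy.
Qed.

Lemma archi_le0 (e D : R) : (forall x, e <= D / x.+1%:R) -> e <= 0.
Proof.
move=> h; rewrite leNgt; apply/negP => e0.
have D0 : 0 < D by have := h 0%N; rewrite divr1; exact: lt_le_trans.
have := h (Num.truncn (D / e)); rewrite leNgt => /negP; apply.
by rewrite ltr_pdivrMr ?ltr0n // mulrC -ltr_pdivrMr // truncnS_gt.
Qed.

Lemma hlim_uniq f l1 l2 : hlim f l1 -> hlim f l2 -> l1 = l2.
Proof.
move=> [D1 h1] [D2 h2]; apply/eqP; rewrite -subr_eq0 -normr_le0.
apply: (@archi_le0 _ (D1 + D2)) => x; rewrite mulrDl.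
apply: le_trans (lerD (h1 x) (h2 x)).
by rewrite -[`|hsum f x - l1|]normrN; apply: le_trans (ler_normD _ _);
  rewrite opprB addrA subrK.
Qed.

(* The sum of the [f n / n], but [0] if [hsum f] does not converge at rate [O(1 / x)]. *)
Definition Lval f : R := xget 0 [set l | hlim f l]%classic.

Lemma Lval_hlim D f : bounded_sums D f -> hlim f (Lval f).
Proof.
move=> /hlim_exists[l lP]; apply: (@xgetPex _ 0 [set l | hlim f l]%classic).
by exists l, D.
Qed.

Lemma LvalP D f x : bounded_sums D f -> `|hsum f x - Lval f| <= D / x.+1%:R.
Proof.
move=> bf; have [l lP] := hlim_exists bf.
by rewrite (hlim_uniq (Lval_hlim bf) (l2 := l)) //; exists D.
Qed.

Lemma Lval_eq f l : hlim f l -> Lval f = l.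
Proof.
move=> fl; apply: (hlim_uniq _ fl).
by apply: (@xgetPex _ 0 [set l | hlim f l]%classic); exists l.
Qed.

Lemma hlim_lin (I : Type) (r : seq I) (c : I -> R) (F : I -> nat -> R) l :
  (forall i, hlim (F i) (l i)) ->
  hlim (fun n => \sum_(i <- r) c i * F i n) (\sum_(i <- r) c i * l i).
Proof.
move=> h; elim: r => [|i r [D IH]].
  by exists 0 => x; rewrite /hsum big_nil big1 ?subrr ?normr0 ?mul0r // => n _;
    rewrite big_nil mul0r.
have [Di hi] := h i; exists (`|c i| * Di + D) => x.
have -> : hsum (fun n => \sum_(j <- i :: r) c j * F j n) x =
          c i * hsum (F i) x + hsum (fun n => \sum_(j <- r) c j * F j n) x.
  rewrite /hsum mulr_sumr -big_split /=; apply: eq_bigr => n _.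
  by rewrite big_cons mulrDl mulrA.
rewrite big_cons opprD addrACA -mulrBr mulrDl.
apply: le_trans (ler_normD _ _) _; rewrite lerD // normrM -mulrA ler_wpM2l //.
Qed.

Lemma ln_div_decr n : (4 <= n)%N -> ln n.+1%:R / n.+1%:R <= ln n%:R / n%:R :> R.
Proof.
move=> n4; have n0 : (0 < n)%N by lia.
have np : 0 < n%:R :> R by rewrite ltr0n.
have := ln_succ_sub R n0; set a := ln n.+1%:R; set b := ln n%:R => ab.
have b1 : 1 <= b.
  have : ln 4%:R <= b by rewrite ler_ln ?posrE ?ltr0n // ler_nat.
  have -> : 4%:R = (2^-1) ^- 2 :> R by field.
  rewrite lnV ?lnXn ?posrE ?exprn_gt0 // ?invr_gt0 //.
  have h : -1 < - 2^-1 :> R by lra.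
  have := le_ln1Dx h; rewrite (_ : 1 - 2^-1 = 2^-1); last by field.
  by move: (ln _) => c; rewrite -mulr_natr; lra.
rewrite ler_pdivrMr ?ltr0n // -natr1 mulrDr mulr1 divfK ?gt_eqF //.
have : n%:R^-1 <= b / n%:R by rewrite ler_peMl ?invr_ge0 // ltW.
clearbody a b; lra.
Qed.

Lemma ln_hsum_bounded D f : bounded_sums D f ->
  exists C, forall x, `|\sum_(1 <= n < x.+1) f n / n%:R * ln n%:R| <= C.
Proof.
move=> bf; exists (\sum_(1 <= n < 4) `|f n / n%:R * ln n%:R| + D * (ln 4%:R / 4%:R)) => x.
have D0 : 0 <= D by apply: le_trans (bf 0 0).
have h4 : 0 <= ln 4%:R / 4%:R :> R by rewrite divr_ge0 // ln_ge0 // ler1n.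
have [x4|x4] := leqP x.+1 4.
  apply: le_trans (ler_norm_sum _ _ _) _; rewrite -[leLHS]addr0 lerD ?(mulr_ge0 D0 h4) //.
  by rewrite [leRHS](@big_cat_nat _ _ _ x.+1) //= lerDl sumr_ge0.
rewrite (@big_cat_nat _ _ _ 4) //=; last by rewrite ltnW.
apply: le_trans (ler_normD _ _) _; rewrite lerD ?ler_norm_sum //.
under eq_bigr => n _ do rewrite mulrAC -mulrA.
apply: (abel_bound _ bf) => n n4; last exact: ln_div_decr.
by rewrite divr_ge0 // ln_ge0 // ler1n; lia.
Qed.

End Abel.

Section LSeries.
Variables (R : realType).
Local Notation mangoldt := (@mangoldt R).
Implicit Types (f : nat -> R).

Definition dilate f m n := f (m * n)%N.

Lemma mangoldt_Lval D f : (forall m, bounded_sums D (dilate f m)) ->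
  exists C, forall x,
    `|\sum_(1 <= m < x.+1) mangoldt m / m%:R * Lval (dilate f m)| <= C.
Proof.
move=> bf.
have bf1 : bounded_sums D f.
  move=> i j; have := bf 1%N i j; rewrite (eq_bigr f) // => n _.
  by rewrite /dilate mul1n.
have [C hC] := ln_hsum_bounded bf1; exists (C + 4 * D) => x.
have D0 : 0 <= D by apply: le_trans (bf 0 0 0)%N.
have [->|x0] := posnP x.
  rewrite big_geq // normr0 addr_ge0 ?mulr_ge0 //.
  exact: le_trans (normr_ge0 _) (hC 0%N).
have xp : 0 < x%:R :> R by rewrite ltr0n.
have eqS : \sum_(1 <= n < x.+1) f n / n%:R * ln n%:R =
   \sum_(1 <= m < x.+1) mangoldt m / m%:R * hsum (dilate f m) (x %/ m).
  transitivity (\sum_(1 <= n < x.+1) \sum_(m <- divisors n)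
     mangoldt m / m%:R * (f (m * (n %/ m))%N / (n %/ m)%:R)).
    apply: eq_big_nat => n /andP[n0 _]; rewrite -sum_mangoldt // mulr_sumr.
    apply: eq_big_seq => m; rewrite -dvdn_divisors // => mn.
    have nE : n%:R = m%:R * (n %/ m)%:R :> R by rewrite -natrM mulnC divnK.
    by rewrite [(m * _)%N]mulnC divnK // nE invfM; ring.
  rewrite (sum_divisors_swap _ (fun m k => mangoldt m / m%:R * (f (m * k)%N / k%:R))).
  by apply: eq_bigr => m _; rewrite mulr_sumr.
have := hC x; rewrite eqS => hx.
rewrite -[X in `|X|](subrK (\sum_(1 <= m < x.+1) mangoldt m / m%:R * hsum (dilate f m) (x %/
  m))).
rewrite addrC; apply: le_trans (ler_normD _ _) _; rewrite lerD // -sumrB.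
apply: le_trans (ler_norm_sum _ _ _) _.
apply: (@le_trans _ _ (\sum_(1 <= m < x.+1) mangoldt m * (D / x%:R))); last first.
  rewrite -mulr_suml -/(chebyshev_psi R x) mulrA ler_pdivrMr //.
  by rewrite mulrAC ler_wpM2r // psi_le.
rewrite big_nat_cond [leRHS]big_nat_cond; apply: ler_sum => m /andP[/andP[m0 _] _].
have mp : 0 < m%:R :> R by rewrite ltr0n.
rewrite -mulrBr normrM ger0_norm ?divr_ge0 ?mangoldt_ge0 //.
rewrite -mulrA ler_wpM2l ?mangoldt_ge0 // distrC.
rewrite ler_pdivrMl //; apply: le_trans (LvalP _ (bf m)) _.
rewrite mulrCA ler_wpM2l // -[leRHS]invrK invf_div lef_pV2 ?posrE ?divr_gt0 ?ltr0n //.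
by rewrite ltW // natr_div_lt.
Qed.

Lemma mangoldt_Lval0 D f : (forall m, bounded_sums D (dilate f m)) ->
  (forall m, Lval (dilate f m) = 0) ->
  exists C, forall x, (0 < x)%N ->
    `|\sum_(1 <= n < x.+1) mangoldt n / n%:R * f n + f 1%N * ln x%:R| <= C.
Proof.
move=> bf L0; exists D => x x0.
have xp : 0 < x%:R :> R by rewrite ltr0n.
have D0 : 0 <= D by apply: le_trans (bf 0 0 0)%N.
have -> : \sum_(1 <= n < x.+1) mangoldt n / n%:R * f n + f 1%N * ln x%:R =
   \sum_(1 <= m < x.+1) moebius R m * ln (x%:R / m%:R) / m%:R * hsum (dilate f m) (x %/ m).
  transitivity (\sum_(1 <= n < x.+1) \sum_(m <- divisors n)
     moebius R m * ln (x%:R / m%:R) / m%:R * (f (m * (n %/ m))%N / (n %/ m)%:R)).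
    transitivity (\sum_(1 <= n < x.+1) ((n == 1%N)%:R * ln x%:R + mangoldt n) * (f n / n%:R)).
      rewrite [RHS](eq_bigr (fun n => mangoldt n / n%:R * f n +
         (n == 1%N)%:R * ln x%:R * (f n / n%:R))); last first.
        by move=> n _; rewrite mulrDl addrC; congr (_ + _); rewrite mulrA [RHS]mulrAC.
      rewrite big_split /=; congr (_ + _); rewrite big_ltn // eqxx mul1r divr1 mulrC.
      rewrite big_nat_cond big1 ?addr0 // => n /andP[/andP[n1 _] _].
      by rewrite gtn_eqF // !mul0r.
    apply: eq_big_nat => n /andP[n0 _].
    rewrite -sum_moebius_ln_div // mulr_suml.
    apply: eq_big_seq => m; rewrite -dvdn_divisors // => mn.
    rewrite [(m * _)%N]mulnC divnK // -!mulrA; congr (_ * (_ * _)).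
    by rewrite mulrCA -invfM -natrM [(m * _)%N]mulnC divnK.
  rewrite (sum_divisors_swap _ (fun m k => moebius R m * ln (x%:R / m%:R) / m%:R
     * (f (m * k)%N / k%:R))).
  by apply: eq_bigr => m _; rewrite mulr_sumr.
apply: le_trans (ler_norm_sum _ _ _) _.
apply: (@le_trans _ _ (\sum_(1 <= m < x.+1) (ln x%:R - ln m%:R) * (D / x%:R))); last first.
  rewrite -mulr_suml mulrA ler_pdivrMr // mulrC ler_wpM2l // sumrB sumr_const_nat subn1 /=.
  have -> : \sum_(1 <= i < x.+1) ln i%:R = ln (x`!)%:R :> R.
    elim: (x) => [|n IH]; first by rewrite big_geq // fact0 ln1.
    rewrite big_nat_recr //= IH factS natrM lnM ?posrE ?ltr0n ?fact_gt0 //.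
    exact: addrC.
  by have := ln_fact_ge R x; rewrite -mulr_natl; lra.
rewrite big_nat_cond [leRHS]big_nat_cond; apply: ler_sum => m /andP[/andP[m0 mx] _].
have mp : 0 < m%:R :> R by rewrite ltr0n.
have mi : 0 <= m%:R^-1 :> R by rewrite invr_ge0.
have lnxm : 0 <= ln (x%:R / m%:R) :> R.
  by rewrite ln_ge0 // ler_pdivlMr // mul1r ler_nat.
rewrite -ln_div ?posrE // !normrM (ger0_norm lnxm) (ger0_norm mi).
rewrite -[leRHS]mul1r -!mulrA ler_pM ?mulr_ge0 ?moebius_norm //.
rewrite ler_wpM2l // ler_pdivrMl //.
have := LvalP (x %/ m) (bf m); rewrite L0 subr0 => /le_trans; apply.
rewrite mulrCA ler_wpM2l // -[leRHS]invrK invf_div lef_pV2 ?posrE ?divr_gt0 ?ltr0n //.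
by rewrite ltW // natr_div_lt.
Qed.

End LSeries.

(** * Real characters *)

Section RealCharacter.
Variable R : realType.
Variable chi : nat -> R.
Hypothesis chi1 : chi 1%N = 1.
Hypothesis chiM : forall m n, chi (m * n)%N = chi m * chi n.
Hypothesis chi_val : forall n, [\/ chi n = 0, chi n = 1 | chi n = -1].

Let r n := \sum_(m <- divisors n) chi m.

Lemma sign_power_sum (t : R) b : [\/ t = 0, t = 1 | t = -1] ->
  (~~ odd b)%:R <= \sum_(0 <= i < b.+1) t ^+ i.
Proof.
move=> tv; have tp : 0 <= 1 + t by case: tv => ->; rewrite ?addr0 ?subrr ?addr_ge0.
suff : (~~ odd b)%:R <= \sum_(0 <= i < b.+1) t ^+ i /\
       (0 <= \sum_(0 <= i < b.+1) t ^+ i).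
  by case.
elim/ltn_ind: b => -[|[|b]] IH.
- by rewrite big_nat1 expr0.
- by rewrite big_nat_recr //= big_nat1 expr0 expr1.
have [IH1 IH2] := IH b (ltnW (ltnSn _)).
have {}IH1 : (~~ odd b)%:R <= \sum_(0 <= i < b.+3) t ^+ i.
  rewrite big_nat_recl // big_nat_recl // expr0 expr1.
  under eq_bigr => i _ do rewrite exprSr exprSr -mulrA -expr2.
  rewrite -mulr_suml addrA.
  have [t2|t2] : t ^+ 2 = 0 \/ t ^+ 2 = 1.
    by case: tv => ->; rewrite ?expr0n ?expr1n ?sqrrN ?expr1n; [left|right|right].
  - have t0 : t = 0 by apply/eqP; rewrite -sqrf_eq0 t2.
    by rewrite t2 mulr0 t0 !addr0; case: (odd b).
  - by rewrite t2 mulr1 (le_trans IH1) // lerDr.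
split; first by rewrite /= negbK.
by apply: le_trans IH1; case: odd.
Qed.

Lemma divisor_sum_pfactor p a n : prime p -> (0 < n)%N -> ~~ (p %| n)%N ->
  r (p ^ a * n) = (\sum_(0 <= i < a.+1) chi p ^+ i) * r n.
Proof.
move=> pp n0 pn; rewrite /r sum_divisors_pfactor // mulr_suml.
apply: eq_bigr => i _; rewrite mulr_sumr; apply: eq_bigr => m _.
rewrite chiM; congr (_ * _).
by elim: i => [|i IH]; rewrite ?expn0 ?expr0 // expnS exprS chiM IH.
Qed.

Lemma divisor_sum_ge0 n : (0 < n)%N -> 0 <= r n.
Proof.
move: n; apply: prime_factor_ind => [|p a n pp n0 pn IH].
  by rewrite /r big_seq1 chi1.
rewrite divisor_sum_pfactor // mulr_ge0 //.
by apply: le_trans (sign_power_sum _ (chi_val p)).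
Qed.

Lemma divisor_sum_sqr n : (0 < n)%N -> 1 <= r (n ^ 2).
Proof.
move: n; apply: prime_factor_ind => [|p a n pp n0 pn IH].
  by rewrite /r big_seq1 chi1.
rewrite expnMn -expnM divisor_sum_pfactor ?expn_gt0 ?n0 //; last first.
  by rewrite Euclid_dvdX // andbT.
rewrite -[1]mul1r ler_pM //.
apply: le_trans (sign_power_sum _ (chi_val p)).
by rewrite muln2 odd_double.
Qed.

(* The sum of [max 0 (x - m k)] over [k >= 1]: subtracting [k m] from [x], rather than
   counting the [k <= x / m], brings the error in the linear approximation of [G_approx]
   down to [O(m)], so that the split at [x ^ (2/3)] beats the [x ^ (3/2)] of the squares. *)
Let G x m : R := \sum_(1 <= k < (x %/ m).+1) (x%:R - (m * k)%:R).

Lemma smoothed_sumE x : \sum_(1 <= n < x.+1) r n * (x%:R - n%:R) =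
  \sum_(1 <= m < x.+1) chi m * G x m.
Proof.
transitivity (\sum_(1 <= n < x.+1) \sum_(m <- divisors n)
   chi m * (x%:R - (m * (n %/ m))%:R)).
  apply: eq_big_nat => n /andP[n0 _]; rewrite /r mulr_suml.
  apply: eq_big_seq => m; rewrite -dvdn_divisors // => mn.
  by rewrite [(m * _)%N]mulnC divnK.
rewrite (sum_divisors_swap _ (fun m k => chi m * (x%:R - (m * k)%:R))).
by apply: eq_bigr => m _; rewrite /G mulr_sumr.
Qed.

Lemma G_term_ge0 x m k : (0 < m)%N -> (k < (x %/ m).+1)%N ->
  0 <= x%:R - (m * k)%:R :> R.
Proof.
move=> m0; rewrite ltnS leq_divRL // => kx.
by rewrite subr_ge0 ler_nat mulnC.
Qed.

Lemma G_ge0 x m : (0 < m)%N -> 0 <= G x m.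
Proof.
move=> m0; rewrite /G big_nat_cond; apply: sumr_ge0 => k /andP[/andP[_ kx] _].
exact: G_term_ge0.
Qed.

Lemma G_decr x m : (0 < m)%N -> G x m.+1 <= G x m.
Proof.
move=> m0; have le_q : (x %/ m.+1 <= x %/ m)%N by rewrite leq_div2l.
rewrite {2}/G (@big_cat_nat _ _ _ (x %/ m.+1).+1) //= -[leLHS]addr0 lerD //.
  by apply: ler_sum => k _; rewrite lerD2l lerN2 ler_nat leq_mul.
rewrite big_nat_cond; apply: sumr_ge0 => k /andP[/andP[_ kx] _].
exact: G_term_ge0.
Qed.

Lemma GE x m (q := (x %/ m)%N) :
  G x m = q%:R * x%:R - m%:R * (q%:R * (q%:R + 1)) / 2.
Proof.
rewrite /G -/q; elim: q => [|q IH]; first by rewrite big_geq // !mul0r mulr0 mul0r subr0.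
by rewrite big_nat_recr //= IH natrM -!natr1; field.
Qed.

Lemma G_le x m : (0 < m)%N -> G x m <= x%:R ^+ 2 / m%:R.
Proof.
move=> m0; rewrite GE; set q := (x %/ m)%N.
apply: (@le_trans _ _ (q%:R * x%:R)).
  by rewrite gerBl divr_ge0 // !mulr_ge0 // addr_ge0.
by rewrite expr2 mulrAC ler_wpM2r // natr_div_ge.
Qed.

Lemma G_approx x m : (0 < m)%N ->
  `|G x m - (x%:R ^+ 2 / 2 / m%:R - x%:R / 2)| <= m%:R.
Proof.
move=> m0; rewrite GE.
have xE : x%:R = (x %/ m)%:R * m%:R + (x %% m)%:R :> R.
  by rewrite -natrM -natrD -divn_eq.
have : (x %% m)%:R <= m%:R :> R by rewrite ler_nat ltnW // ltn_pmod.
have : 0 <= (x %% m)%:R :> R by [].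
have : 0 < m%:R :> R by rewrite ltr0n.
rewrite xE; move: (x %/ m)%N%:R (x %% m)%N%:R m%:R => q s t t0 s0 st.
have -> : q * (q * t + s) - t * (q * (q + 1)) / 2 -
   ((q * t + s) ^+ 2 / 2 / t - (q * t + s) / 2) = s * (t - s) / (2 * t).
  by field; lra.
rewrite ger0_norm; last by rewrite divr_ge0 // mulr_ge0 //; lra.
by rewrite ler_pdivrMr; nra.
Qed.

Lemma real_character_L_neq0 D : bounded_sums D chi -> ~ hlim chi 0.
Proof.
move=> bchi chi0; have D0 : 0 <= D by apply: le_trans (bchi 0 0)%N.
have hs x : `|hsum chi x| <= D / x.+1%:R.
  by have := LvalP x bchi; rewrite (Lval_eq chi0) subr0.
have key y : (1 < y)%N -> y%:R ^+ 9 / 4%:R <= (2 * D + 1) * y%:R ^+ 8 :> R.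
  move=> y1; set x := (y ^ 6)%N; set z := (y ^ 3)%N; set M := (y ^ 4)%N.
  have y0 : (0 < y)%N by lia.
  have xz : x = (z * z)%N by rewrite /x /z -expnD.
  have M0 : (0 < M)%N by rewrite expn_gt0 y0.
  have Mx : (M <= x)%N by rewrite leq_pexp2l.
  have z2 : (2 <= z)%N by rewrite /z (leq_trans y1) // -{1}[y]expn1 leq_pexp2l.
  have yp : 0 < y%:R :> R by rewrite ltr0n.
  have y1' : 1 <= y%:R :> R by rewrite ler1n.
  apply: (@le_trans _ _ (\sum_(1 <= n < x.+1) r n * (x%:R - n%:R))).
    apply: (@le_trans _ _ (\sum_(1 <= k < z.+1) (x%:R - (k ^ 2)%:R))).
      apply: (@le_trans _ _ (\sum_(1 <= k < z.+1) (z%:R * (z%:R - k%:R)))).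
        rewrite -mulr_sumr.
        have -> : \sum_(1 <= k < z.+1) (z%:R - k%:R) = z%:R * (z%:R - 1) / 2 :> R.
          rewrite sumrB sumr_const_nat subn1 /= -[z%:R *+ z]mulr_natr.
          have -> : \sum_(1 <= k < z.+1) k%:R = z%:R * (z%:R + 1) / 2 :> R.
            elim: (z) => [|n IH]; first by rewrite big_geq // !mul0r.
            by rewrite big_nat_recr //= IH -natr1; field.
          by field.
        have -> : y%:R ^+ 9 = z%:R ^+ 3 :> R by rewrite /z natrX -exprM.
        have z2' : 2 <= z%:R :> R by rewrite ler_nat.
        move: (z%:R) z2' => w w2.
        have -> : w * (w * (w - 1) / 2) = w ^+ 3 / 4%:R + w ^+ 2 * (w - 2) / 4%:R by field.
        by rewrite lerDl divr_ge0 // mulr_ge0 ?sqr_ge0 //; lra.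
      rewrite big_nat_cond [leRHS]big_nat_cond; apply: ler_sum => k.
      move=> /andP[/andP[k0 kz] _]; rewrite xz natrM natrX mulrBr lerD2l lerN2.
      by rewrite expr2 ler_wpM2r // ler_nat.
    apply: (@le_trans _ _ (\sum_(1 <= k < z.+1) \sum_(1 <= n < x.+1)
        (n == k ^ 2)%N%:R * (x%:R - n%:R))).
      rewrite big_nat_cond [leRHS]big_nat_cond; apply: ler_sum => k.
      move=> /andP[/andP[k0 kz] _].
      have kx : (k ^ 2 <= x)%N by rewrite xz expnS expn1 leq_mul.
      rewrite (big_rem (k ^ 2)%N) /=; last by rewrite mem_index_iota expn_gt0 k0 ltnS kx.
      rewrite eqxx mul1r lerDl sumr_ge0 // => n _.
      case: eqP => [->|_]; rewrite ?mul0r // mul1r subr_ge0 ler_nat //.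
    rewrite exchange_big_nat /=.
    rewrite big_nat_cond [leRHS]big_nat_cond; apply: ler_sum => n.
    move=> /andP[/andP[n0 nx] _]; rewrite -mulr_suml.
    apply: ler_wpM2r; first by rewrite subr_ge0 ler_nat.
    have [k kP|nok] := pickP (fun k : 'I_z.+1 => (0 < k)%N && (n == k ^ 2)%N).
      have /andP[k0 /eqP nk] := kP.
      rewrite (big_rem (k : nat)) /=; last by rewrite mem_index_iota k0 ltn_ord.
      rewrite nk eqxx big_seq big1 ?addr0 ?divisor_sum_sqr // => j.
      rewrite mem_rem_uniq ?iota_uniq // inE => /andP[jk _].
      by rewrite eqn_exp2r // eq_sym (negbTE jk).
    rewrite big_nat_cond big1 ?divisor_sum_ge0 // => k /andP[/andP[k0 kz] _].
    by have := nok (Ordinal kz); rewrite /= k0 /= => ->.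
  rewrite smoothed_sumE (@big_cat_nat _ _ _ M.+1) //=.
  apply: le_trans (ler_norm _) _; apply: le_trans (ler_normD _ _) _.
  have tail : `|\sum_(M.+1 <= m < x.+1) chi m * G x m| <= D * y%:R ^+ 8.
    apply: (@le_trans _ _ (D * G x M.+1)).
      apply: abel_bound => // n Mn;
        [exact/G_ge0/(leq_trans _ Mn)|exact/G_decr/(leq_trans _ Mn)].
    rewrite ler_wpM2l //; apply: le_trans (G_decr x M0) _.
    apply: le_trans (G_le x M0) _.
    by rewrite ler_pdivrMr ?ltr0n // -!natrX -natrM ler_nat /x /M -!expnM -expnD.
  have head : `|\sum_(1 <= m < M.+1) chi m * G x m| <= (D + 1) * y%:R ^+ 8.
    have -> : \sum_(1 <= m < M.+1) chi m * G x m =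
       x%:R ^+ 2 / 2 * hsum chi M - x%:R / 2 * (\sum_(1 <= m < M.+1) chi m) +
       \sum_(1 <= m < M.+1) chi m * (G x m - (x%:R ^+ 2 / 2 / m%:R - x%:R / 2)).
      rewrite /hsum !mulr_sumr -sumrB -big_split /=; apply: eq_bigr => m _.
      move: (G x m) (m%:R^-1) => g u; ring.
    apply: le_trans (ler_normD _ _) _.
    rewrite mulrDl mul1r lerD //; last first.
      apply: le_trans (ler_norm_sum _ _ _) _.
      apply: (@le_trans _ _ (\sum_(1 <= m < M.+1) M%:R)).
        rewrite big_nat_cond [leRHS]big_nat_cond; apply: ler_sum => m.
        move=> /andP[/andP[m0 mM] _]; rewrite normrM -[leRHS]mul1r ler_pM //.
          by case: (chi_val m) => ->; rewrite ?normr0 ?normrN ?normr1.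
        by apply: le_trans (G_approx _ m0) _; rewrite ler_nat.
      by rewrite sumr_const_nat subn1 /= -[_ *+ M]mulr_natr /M -natrM -natrX ler_nat -expnD.
    apply: le_trans (ler_normB _ _) _.
    have -> : D * y%:R ^+ 8 = D * y%:R ^+ 8 / 2 + D * y%:R ^+ 8 / 2 by field.
    rewrite lerD // normrM ger0_norm ?divr_ge0 ?exprn_ge0 //.
      apply: (@le_trans _ _ (x%:R ^+ 2 / 2 * (D / M%:R))).
        rewrite ler_wpM2l ?divr_ge0 ?exprn_ge0 //; apply: le_trans (hs M) _.
        by rewrite ler_wpM2l // lef_pV2 ?posrE ?ltr0n // ler_nat.
      rewrite le_eqVlt; apply/orP; left; apply/eqP.
      by rewrite /x /M !natrX; field; rewrite gt_eqF.
    apply: (@le_trans _ _ (x%:R / 2 * D)); first by rewrite ler_wpM2l ?divr_ge0.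
    rewrite mulrAC ler_pM2r ?invr_gt0 // mulrC ler_wpM2l //.
    by rewrite /x -natrX ler_nat leq_pexp2l.
  apply: le_trans (lerD head tail) _.
  by rewrite -mulrDl ler_wpM2r ?exprn_ge0 //; lra.
pose y := (Num.truncn (4%:R * (2 * D + 1)) + 2)%N.
have := key y; rewrite /y; set t := Num.truncn _ => h.
have t1 : (1 < t + 2)%N by lia.
have {}h := h t1.
move: h; rewrite exprS mulrAC ler_pM2r ?exprn_gt0 ?ltr0n ?addn_gt0 ?orbT //.
rewrite ler_pdivrMr // mulrC leNgt => /negP; apply.
by rewrite (lt_le_trans (truncnS_gt _)) // ler_nat addn2.
Qed.

End RealCharacter.

(** * Class functions *)

Section BoundedFor.
Variable R : realType.
Implicit Types u v : nat -> R.

Definition bounded_seq u := exists C, forall x, (0 < x)%N -> `|u x| <= C.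

Lemma eq_bnd u v : (forall x, (0 < x)%N -> u x = v x) -> bounded_seq u -> bounded_seq v.
Proof. by move=> uv [C h]; exists C => x x0; rewrite -uv // h. Qed.

Lemma bounded_seqD u v : bounded_seq u -> bounded_seq v -> bounded_seq (fun x => u x + v x).
Proof.
move=> [C h] [D k]; exists (C + D) => x x0.
by apply: le_trans (ler_normD _ _) _; rewrite lerD ?h ?k.
Qed.

Lemma bounded_seqZ c u : bounded_seq u -> bounded_seq (fun x => c * u x).
Proof.
by move=> [C h]; exists (`|c| * C) => x x0; rewrite normrM ler_wpM2l ?h.
Qed.

Lemma bounded_seqB u v : bounded_seq u -> bounded_seq v -> bounded_seq (fun x => u x - v x).
Proof.
move=> hu hv; apply: eq_bnd (bounded_seqD hu (bounded_seqZ (-1) hv)) => x _.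
by rewrite mulN1r.
Qed.

Lemma bounded_seq_sum (I : Type) (r : seq I) (P : pred I) (F : I -> nat -> R) :
  (forall i, P i -> bounded_seq (F i)) -> bounded_seq (fun x => \sum_(i <- r | P i) F i x).
Proof.
move=> h; elim: r => [|i r IH].
  by exists 0 => x _; rewrite big_nil normr0.
case Pi : (P i); last by apply: eq_bnd IH => x _; rewrite big_cons Pi.
by apply: eq_bnd (bounded_seqD (h i Pi) IH) => x _; rewrite big_cons Pi.
Qed.

Lemma bounded_seq_ln c : bounded_seq (fun x => c * ln x%:R) -> c = 0.
Proof.
move=> [C h]; apply/eqP; apply/negP => /negP c0.
have cp : 0 < `|c| by rewrite normr_gt0.
set t := expR (C / `|c| + 1).
have tp : 0 < t by exact: expR_gt0.
have := h (Num.truncn t).+1 isT; rewrite normrM leNgt => /negP; apply.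
rewrite mulrC -ltr_pdivrMr //.
apply: lt_le_trans (ler_norm _).
apply: (@lt_trans _ _ (ln t)); first by rewrite /t expRK ltrDl.
by rewrite ltr_ln ?posrE ?ltr0n // truncnS_gt.
Qed.

End BoundedFor.

Section ClassFunctions.
Variables (R : realType) (d : nat).
Hypothesis d0 : (0 < d)%N.
Implicit Types f u : nat -> R.

Definition periodic (T : Type) (f : nat -> T) := forall n, f (n + d)%N = f n.

Lemma periodic_mod (T : Type) (f : nat -> T) n : periodic f -> f (n %% d)%N = f n.
Proof.
move=> pf; rewrite [in RHS](divn_eq n d); elim: (n %/ d)%N => [|q IH]; first by rewrite mul0n.
by rewrite mulSn -addnA addnC pf.
Qed.

Lemma periodic_eqmod (T : Type) (f : nat -> T) m n : periodic f -> m = n %[mod d] -> f m = f n.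
Proof. by move=> pf mn; rewrite -(periodic_mod m pf) mn periodic_mod. Qed.

Lemma periodic_dilate f m : periodic f -> periodic (dilate f m).
Proof.
move=> pf n; rewrite /dilate; apply: periodic_eqmod => //.
by rewrite mulnDr addnC modnMDl.
Qed.

Lemma mod_inverse m : coprime m d -> exists k, (m * k = 1 %[mod d])%N.
Proof.
move=> md; have [m0|m0] := posnP m.
  by exists 0%N; move: md; rewrite m0 /coprime gcd0n => /eqP->; rewrite !modn1.
have [[a b] /= e] := coprimeP d m0 md; exists a.
have -> : (m * a = b * d + 1)%N by lia.
by rewrite modnMDl.
Qed.

Lemma mod_mul_inj m i j : coprime m d -> (i < d)%N -> (j < d)%N ->
  m * i = m * j %[mod d] -> i = j.
Proof.
move=> md id jd e; have [k mk] := mod_inverse md.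
have h n : (k * (m * n) = n %[mod d])%N.
  by rewrite mulnA [(k * m)%N]mulnC -modnMml mk modnMml mul1n.
have : (i = j %[mod d])%N by rewrite -(h i) -(h j) -modnMmr e modnMmr.
by rewrite !modn_small.
Qed.

Lemma sum_dilate f m : periodic f -> coprime m d ->
  \sum_(n < d) f (m * n)%N = \sum_(n < d) f n.
Proof.
move=> pf md; pose h (i : 'I_d) : 'I_d := Ordinal (ltn_pmod (m * i) d0).
have hinj : injective h.
  move=> i j /(congr1 val) /= e; apply/val_inj; exact: mod_mul_inj e.
rewrite [RHS](reindex_inj hinj) /=; apply: eq_bigr => i _.
by rewrite periodic_mod.
Qed.

(* Functions of mean 0 on the units mod [d], extended by 0. *)
Definition mean0_class f := [/\ periodic f, forall n, ~~ coprime n d -> f n = 0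
  & \sum_(n < d) f n = 0].

Lemma mean0_class_dilate f m : mean0_class f -> mean0_class (dilate f m).
Proof.
move=> [pf cf sf]; split; first exact: periodic_dilate.
  by move=> n nd; apply: cf; rewrite coprimeMl (negbTE nd) andbF.
have [md|md] := boolP (coprime m d); first by rewrite sum_dilate.
by rewrite big1 // => n _; rewrite /dilate cf // coprimeMl (negbTE md).
Qed.

Lemma periodic_prefix f q n : periodic f -> \sum_(k < d) f k = 0 ->
  \sum_(0 <= k < q * d + n) f k = \sum_(0 <= k < n) f k.
Proof.
move=> pf sf; elim: q => [|q IH] //; rewrite mulSn -addnA.
rewrite (@big_cat_nat _ _ _ d) //= ?leq_addr // big_mkord sf add0r -[d in X in \sum_(X <= _ <
  _) _]add0n.
rewrite big_addn addnC addnK -IH; apply: eq_bigr => k _; exact: pf.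
Qed.

Lemma mean0_class_bounded f : mean0_class f ->
  exists D, forall m, bounded_sums D (dilate f m).
Proof.
move=> zf; have [pf _ _] := zf.
pose K := \sum_(n < d) `|f n|.
have fK n : `|f n| <= K.
  rewrite -(periodic_mod n pf) /K (bigD1 (Ordinal (ltn_pmod n d0))) //=.
  by rewrite lerDl sumr_ge0.
have K0 : 0 <= K by exact: le_trans (fK 0%N).
clearbody K; exists (2 * (d%:R * K)) => m; have [pm _ sm] := mean0_class_dilate m zf.
have pre j : `|\sum_(0 <= k < j) dilate f m k| <= d%:R * K.
  rewrite (divn_eq j d) periodic_prefix //.
  apply: le_trans (ler_norm_sum _ _ _) _.
  apply: (@le_trans _ _ (\sum_(0 <= k < j %% d) K)); first by apply: ler_sum => k _; exact: fK.
  rewrite sumr_const_nat subn0 -[K *+ _]mulr_natl ler_wpM2r //.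
  by rewrite ler_nat ltnW // ltn_pmod.
move=> i j; have [ij|/ltnW ji] := leqP i j; last first.
  by rewrite big_geq // normr0 !mulr_ge0.
have -> : \sum_(i <= n < j) dilate f m n =
    \sum_(0 <= n < j) dilate f m n - \sum_(0 <= n < i) dilate f m n.
  by rewrite [X in _ = X - _](@big_cat_nat _ _ _ i) //= addrAC subrr add0r.
apply: le_trans (ler_normB _ _) _.
by rewrite mulrDl mul1r lerD.
Qed.

Lemma dilateM f m n : dilate (dilate f m) n = dilate f (m * n).
Proof. by apply/funext => k; rewrite /dilate mulnA. Qed.

Lemma dilate1 f : dilate f 1 = f.
Proof. by apply/funext => k; rewrite /dilate mul1n. Qed.

Lemma Lval0 : Lval (fun _ => 0 : R) = 0.
Proof.
apply: Lval_eq; exists 0 => x; rewrite /hsum big1 ?subrr ?normr0 ?mul0r // => n _.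
by rewrite mul0r.
Qed.

Lemma Lval_eqmod f m n : periodic f -> m = n %[mod d] ->
  Lval (dilate f m) = Lval (dilate f n).
Proof.
move=> pf mn; congr Lval; apply/funext => k; apply: (periodic_eqmod pf).
by rewrite -modnMml mn modnMml.
Qed.

Lemma Lval_ncoprime f m : mean0_class f -> ~~ coprime m d -> Lval (dilate f m) = 0.
Proof.
move=> [_ cf _] md; rewrite (_ : dilate f m = fun=> 0) ?Lval0 //.
by apply/funext => k; rewrite /dilate cf // coprimeMl (negbTE md).
Qed.

Lemma Lval_lin (I : Type) (r : seq I) (c : I -> R) (F : I -> nat -> R) :
  (forall i, mean0_class (F i)) ->
  Lval (fun n => \sum_(i <- r) c i * F i n) = \sum_(i <- r) c i * Lval (F i).
Proof.
move=> h; apply: Lval_eq; apply: hlim_lin => i.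
have [D bD] := mean0_class_bounded (h i).
by apply: (@Lval_hlim _ D); have := bD 1%N; rewrite dilate1.
Qed.

Definition mertens_sum (P : pred nat) (x : nat) : R :=
  \sum_(1 <= n < x.+1 | P n) mangoldt R n / n%:R.

Lemma mertens_term_ge0 n : 0 <= mangoldt R n / n%:R.
Proof. by rewrite divr_ge0 // mangoldt_ge0. Qed.

Lemma mertens_sum_le (P Q : pred nat) x : (forall n,
  P n -> Q n) -> mertens_sum P x <= mertens_sum Q x.
Proof.
move=> PQ; rewrite /mertens_sum big_mkcond [leRHS]big_mkcond; apply: ler_sum => n _.
by case: ifP => [/PQ->|_] //; case: ifP => // _; exact: mertens_term_ge0.
Qed.

Lemma mertens_sum_ge0 P x : 0 <= mertens_sum P x.
Proof. by apply: sumr_ge0 => n _; exact: mertens_term_ge0. Qed.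

Lemma mertens_sum_split P Q x : mertens_sum P x =
  mertens_sum (fun n => P n && Q n) x + mertens_sum (fun n => P n && ~~ Q n) x.
Proof. exact: bigID. Qed.

Lemma bounded_seq_mertens_sum_sparse (P : pred nat) N :
  (forall n, P n -> prime n -> (n <= N)%N) -> bounded_seq (mertens_sum P).
Proof.
move=> PN; exists (4 + \sum_(1 <= n < N.+1) mangoldt R n / n%:R) => x x0.
rewrite ger0_norm ?mertens_sum_ge0 // (mertens_sum_split P (fun n => ~~ prime n)) lerD //.
  apply: le_trans (mangoldt_nonprime R x).
  by rewrite -/(mertens_sum (fun n => ~~ prime n) x); apply: mertens_sum_le => n /andP[].
apply: (@le_trans _ _ (mertens_sum (fun n => n <= N)%N x)).
  by apply: mertens_sum_le => n /andP[Pn]; rewrite negbK; exact: PN.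
rewrite /mertens_sum; have [xN|Nx] := leqP x N.
  rewrite [leRHS](@big_cat_nat _ _ _ x.+1) //= -[leLHS]addr0 lerD //; last first.
    by apply: sumr_ge0 => n _; exact: mertens_term_ge0.
  by rewrite big_mkcond; apply: ler_sum => n _; case: ifP => // _; exact: mertens_term_ge0.
rewrite (@big_cat_nat _ _ _ N.+1) //=; last by rewrite ltnW.
rewrite [X in _ + X]big_nat_cond [X in _ + X]big_pred0 ?addr0; last first.
  by move=> n; rewrite ltnNge; case: (n <= N)%N; rewrite ?andbF.
by rewrite big_mkcond; apply: ler_sum => n _; case: ifP => // _; exact: mertens_term_ge0.
Qed.

Lemma mertens_sum_coprime : bounded_seq (fun x => mertens_sum (coprime^~ d) x - ln x%:R).
Proof.
have nc : bounded_seq (mertens_sum (fun n => ~~ coprime n d)).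
  apply: (@bounded_seq_mertens_sum_sparse _ d) => n nd pn; apply: dvdn_leq => //.
  by move: nd; rewrite prime_coprime // negbK.
have all_ : bounded_seq (fun x => mertens_sum predT x - ln x%:R).
  exists 4 => x x0; rewrite ler_norml; apply/andP; split.
    by have := mertens_ge R x0; rewrite -/(mertens_sum predT x); lra.
  by have := mertens_le R x0; rewrite -/(mertens_sum predT x); lra.
apply: eq_bnd (bounded_seqB all_ nc) => x _.
rewrite (mertens_sum_split predT (coprime^~ d)) /=; ring.
Qed.

Lemma pos_lower_bound (v : nat -> R) N : (forall n, 0 <= v n) ->
  exists2 e, 0 < e & forall n, (n < N)%N -> v n != 0 -> e <= v n.
Proof.
move=> v0; elim: N => [|N [e e0 he]]; first by exists 1.
have [vN|vN] := eqVneq (v N) 0.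
  exists e => // n; rewrite ltnS leq_eqVlt => /predU1P[->|]; last exact: he.
  by rewrite vN eqxx.
exists (Num.min e (v N)); first by rewrite lt_min e0 lt_neqAle eq_sym vN v0.
move=> n; rewrite ltnS leq_eqVlt => /predU1P[->|nN vn]; rewrite ge_min ?lexx ?orbT //.
by rewrite he.
Qed.

End ClassFunctions.

Section Nonvanishing.
Variables (R : realType) (d : nat).
Hypothesis d0 : (0 < d)%N.
Variable f : nat -> R.
Hypothesis zf : mean0_class d f.
Hypothesis fL0 : forall m, Lval (dilate f m) = 0.
Variable h0 : nat.
Hypothesis fh0 : f h0 != 0.

Let pf : periodic d f. Proof. by case: zf. Qed.

(* Congruence of the units [n] and [g] modulo the stabilizer of [f]. *)
Let same g n := coprime n d && [forall h : 'I_d, f (n * h)%N == f (g * h)%N].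
Let anti n := coprime n d && [forall h : 'I_d, f (n * h)%N == - f h].

Lemma forall_resP (a b : nat -> R) : periodic d a -> periodic d b ->
  reflect (forall h, a h = b h) [forall h : 'I_d, a h == b h].
Proof.
move=> pa pb; apply: (iffP forallP) => [e h|e h]; last by rewrite e.
have /eqP := e (Ordinal (ltn_pmod h d0)).
by rewrite /= !periodic_mod.
Qed.

Let pdil m : periodic d (fun h => f (m * h)%N).
Proof. exact: (@periodic_dilate R d f m pf). Qed.

Let popp : periodic d (fun h => - f h). Proof. by move=> n; rewrite pf. Qed.

Lemma sameP g n :
  reflect (coprime n d /\ forall h, f (n * h)%N = f (g * h)%N) (same g n).
Proof.
apply: (iffP andP) => -[nd hh]; split=> //; exact/(forall_resP (pdil n) (pdil g)).
Qed.

Lemma antiP n : reflect (coprime n d /\ forall h, f (n * h)%N = - f h) (anti n).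
Proof.
apply: (iffP andP) => -[nd hh]; split=> //; exact/(forall_resP (pdil n) popp).
Qed.

Lemma f_eqmod m n : m = n %[mod d] -> f m = f n.
Proof. exact: periodic_eqmod. Qed.

Lemma coprime_eqmod m n : m = n %[mod d] -> coprime m d = coprime n d.
Proof. by move=> e; rewrite -coprime_modl e coprime_modl. Qed.

Lemma same_eqmod g m n : m = n %[mod d] -> same g m = same g n.
Proof.
move=> e; rewrite /same (coprime_eqmod e); congr (_ && _).
apply: eq_forallb => h; congr (_ == _); apply: f_eqmod.
by rewrite -modnMml e modnMml.
Qed.

Lemma periodic_same g : periodic d (same g).
Proof. by move=> n; apply: same_eqmod; rewrite addnC modnDl. Qed.

Let corr n : R := \sum_(h < d) f h * f (n * h)%N.

Lemma corr_mean0_class : mean0_class d corr.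
Proof.
split.
- by move=> n; apply: eq_bigr => h _; congr (_ * _); apply: f_eqmod;
  rewrite mulnDl [(d * _)%N]mulnC addnC modnMDl.
- move=> n nd; rewrite /corr big1 // => h _; have [_ cf _] := zf.
  by rewrite [f (n * h)%N]cf ?mulr0 // coprimeMl (negbTE nd).
- rewrite exchange_big /=; apply: big1 => h _; rewrite -mulr_sumr.
  have [_ _ s] := mean0_class_dilate d0 h zf.
  rewrite (eq_bigr (fun n : 'I_d => dilate f h n)) ?s ?mulr0 // => n _.
  by rewrite /dilate mulnC.
Qed.

Lemma corr_L0 m : Lval (dilate corr m) = 0.
Proof.
have -> : dilate corr m = fun n => \sum_(h < d) f h * dilate f (m * h) n.
  by apply/funext => n; apply: eq_bigr => h _; rewrite /dilate mulnAC.
rewrite (Lval_lin d0) => [|h]; last exact: mean0_class_dilate.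
by apply: big1 => h _; rewrite fL0 mulr0.
Qed.

Lemma corr1_gt0 : 0 < corr 1.
Proof.
rewrite /corr (bigD1 (Ordinal (ltn_pmod h0 d0))) //= ltr_pwDl //.
  by rewrite mul1n periodic_mod // -expr2 exprn_even_gt0.
by apply: sumr_ge0 => h _; rewrite mul1n -expr2 sqr_ge0.
Qed.

Lemma corr_add g : coprime g d ->
  (corr 1 + corr g) *+ 2 = \sum_(h < d) (f h + f (g * h)%N) ^+ 2.
Proof.
move=> gd; have sq1 : \sum_(h < d) f h ^+ 2 = corr 1.
  by apply: eq_bigr => h _; rewrite mul1n expr2.
have sqg : \sum_(h < d) f (g * h)%N ^+ 2 = corr 1.
  rewrite (sum_dilate d0 (f := fun n => f n ^+ 2)) // => n; by rewrite pf.
rewrite [RHS](eq_bigr (fun h : 'I_d => f h ^+ 2 + f (g * h)%N ^+ 2 +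
   (f h * f (g * h)%N) *+ 2)); last by move=> h _; ring.
by rewrite !big_split /= sq1 sqg -/(corr g); ring.
Qed.

Lemma anti_of_corr g : coprime g d -> corr 1 + corr g = 0 -> anti g.
Proof.
move=> gd e; apply/andP; split=> //; apply/forallP => h.
have := corr_add gd; rewrite e mul0rn => /esym/eqP.
rewrite psumr_eq0 => [/allP/(_ h (mem_index_enum _))|i _]; last exact: sqr_ge0.
by rewrite /= sqrf_eq0 addrC addr_eq0.
Qed.

Lemma corr_ge g : coprime g d -> 0 <= corr 1 + corr g.
Proof.
move=> gd; have := corr_add gd.
have : 0 <= \sum_(h < d) (f h + f (g * h)%N) ^+ 2 by apply: sumr_ge0 => h _; exact: sqr_ge0.
by rewrite -[_ *+ 2]mulr_natr; lra.
Qed.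

Lemma bounded_seq_not_anti : bounded_seq (mertens_sum R (fun n => coprime n d && ~~ anti n)).
Proof.
have [D bD] := mean0_class_bounded d0 corr_mean0_class.
have [C hC] := mangoldt_Lval0 bD corr_L0.
have [C' hC'] := mertens_sum_coprime R d0.
pose v n := if coprime n d then corr 1 + corr n else 0.
have v0 n : 0 <= v n by rewrite /v; case: ifP => // /corr_ge.
have [e e0 he] := pos_lower_bound d v0.
exists ((C + corr 1 * C') / e) => x x0.
rewrite ger0_norm ?mertens_sum_ge0 // ler_pdivlMr // mulrC.
apply: (@le_trans _ _ (\sum_(1 <= n < x.+1 | coprime n d) mangoldt R n / n%:R * (corr 1 +
  corr n))).
  rewrite /mertens_sum mulr_sumr big_mkcondr /=; apply: ler_sum => n nd.
  case: ifP => na; last by rewrite mulr_ge0 ?mertens_term_ge0 ?corr_ge.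
  rewrite mulrC ler_wpM2l ?mertens_term_ge0 //.
  have := he (n %% d)%N (ltn_pmod n d0); rewrite /v coprime_modl nd.
  rewrite (periodic_mod n (_ : periodic d corr)); last by case: corr_mean0_class.
  apply; apply: contraNneq na => /(anti_of_corr nd) -> //.
have -> : \sum_(1 <= n < x.+1 | coprime n d) mangoldt R n / n%:R * (corr 1 + corr n) =
   corr 1 * (mertens_sum R (coprime^~ d) x - ln x%:R) +
   (\sum_(1 <= n < x.+1) mangoldt R n / n%:R * corr n + corr 1 * ln x%:R).
  rewrite [X in _ = _ + (X + _)](bigID (coprime^~ d)) /= [X in _ = _ + (_ + X + _)]big1
    ?addr0; last first.
    by move=> n nd; have [_ -> //] := corr_mean0_class; rewrite mulr0.
  rewrite mulrBr addrACA [- _ + _]addrC subrr addr0 /mertens_sum mulr_sumr -big_split /=.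
  by apply: eq_bigr => n _; ring.
rewrite addrC lerD //; first exact: le_trans (ler_norm _) (hC x x0).
by rewrite ler_wpM2l ?(ltW corr1_gt0) //; exact: le_trans (ler_norm _) (hC' x x0).
Qed.

Lemma bounded_seq_anti : bounded_seq (fun x => mertens_sum R anti x - ln x%:R).
Proof.
apply: eq_bnd (bounded_seqB (mertens_sum_coprime R d0) bounded_seq_not_anti) => x _.
rewrite (mertens_sum_split R (coprime^~ d) anti) /=.
have -> : mertens_sum R (fun n => coprime n d && anti n) x = mertens_sum R anti x.
  by apply: eq_bigl => n; rewrite /anti andbA andbb.
ring.
Qed.

Lemma anti_exists : exists m0, anti m0.
Proof.
apply: contrapT => na; suff : (1 : R) = 0 by apply/eqP; rewrite oner_eq0.
apply: bounded_seq_ln; apply: eq_bnd (bounded_seqZ (-1) bounded_seq_anti) => x _.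
rewrite mulN1r opprB mul1r /mertens_sum big_pred0 ?subr0 // => n.
by apply/negP => an; apply: na; exists n.
Qed.

(* The last hypothesis holds for all [u] that are invariant under the stabilizer of [f],
   as [anti] is a single coset of it. *)
Lemma concentrated (u : nat -> R) m0 : anti m0 -> mean0_class d u ->
  (forall m m' n, anti m -> anti m' -> u (m * n)%N = u (m' * n)%N) ->
  Lval (dilate u m0) = 0.
Proof.
move=> am0 zu uA; have [D bD] := mean0_class_bounded d0 zu.
have [C hC] := mangoldt_Lval bD.
have LD m : `|Lval (dilate u m)| <= D.
  have := LvalP 0 (bD m); rewrite /hsum big_geq // sub0r normrN; by rewrite divr1.
set l := Lval (dilate u m0).
have LA m : anti m -> Lval (dilate u m) = l.
  by move=> am; congr Lval; apply/funext => n; exact: uA.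
have D0 : 0 <= D by apply: le_trans (LD 0%N).
have b1 : bounded_seq (fun x => \sum_(1 <= m < x.+1) mangoldt R m / m%:R * Lval (dilate u m)).
  by exists C => x _; exact: hC.
have b2 : bounded_seq (fun x =>
  \sum_(1 <= m < x.+1 | ~~ anti m) mangoldt R m / m%:R * Lval (dilate u m)).
  have [C' hC'] := bounded_seq_not_anti; exists (D * C') => x x0.
  apply: le_trans (ler_norm_sum _ _ _) _.
  apply: (@le_trans _ _ (D * mertens_sum R (fun n => coprime n d && ~~ anti n) x)); last first.
    by rewrite ler_wpM2l //; exact: le_trans (ler_norm _) (hC' x x0).
  rewrite /mertens_sum mulr_sumr (bigID (coprime^~ d)) /= [X in _ + X]big1 ?addr0; last first.
    by move=> n /andP[_ nd]; rewrite (Lval_ncoprime zu nd) mulr0 normr0.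
  under [leRHS]eq_bigl => n do rewrite andbC.
  by apply: ler_sum => n _;
    rewrite normrM ger0_norm ?mertens_term_ge0 // mulrC ler_wpM2r ?mertens_term_ge0.
apply: bounded_seq_ln;
  apply: eq_bnd (bounded_seqB (bounded_seqB b1 b2) (bounded_seqZ l bounded_seq_anti)) => x _.
rewrite [X in X - _ - _](bigID anti) /= addrK.
rewrite (eq_bigr (fun m => mangoldt R m / m%:R * l)); last by move=> m /LA ->.
by rewrite -mulr_suml mulrC -/(mertens_sum R anti x); ring.
Qed.

Lemma concentrated_sign (u : nat -> R) m0 : anti m0 -> mean0_class d u ->
  (forall m m' n, anti m -> anti m' -> u (m * n)%N = u (m' * n)%N) ->
  u m0 = - u 1%N.
Proof.
move=> am0 zu uA; have [D bD] := mean0_class_bounded d0 zu.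
have pu : periodic d u by case: zu.
have L0 m : Lval (dilate u m) = 0.
  have [md|md] := boolP (coprime m d); last exact: (Lval_ncoprime zu).
  have [m0d _] := antiP _ am0; have [k mk] := mod_inverse d0 m0d.
  have e : m = (m * k * m0)%N %[mod d].
    by rewrite -mulnA [(k * _)%N]mulnC -modnMmr mk modnMmr muln1.
  rewrite (Lval_eqmod pu e) -dilateM; apply: concentrated => //.
    exact: mean0_class_dilate.
  by move=> i j n ai aj; rewrite /dilate !(mulnCA (m * k)); exact: uA.
have [C hC] := mangoldt_Lval0 bD L0.
have uD : exists K, forall n, `|u n| <= K.
  exists D => n; have := bD 1%N n n.+1; rewrite big_nat1 /dilate mul1n; exact.
have [K uK] := uD; have K0 : 0 <= K by apply: le_trans (uK 0%N).
have b1 : bounded_seq (fun x =>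
  \sum_(1 <= n < x.+1) mangoldt R n / n%:R * u n + u 1%N * ln x%:R).
  by exists C.
have b2 : bounded_seq (fun x => \sum_(1 <= m < x.+1 | ~~ anti m) mangoldt R m / m%:R * u m).
  have [C' hC'] := bounded_seq_not_anti; exists (K * C') => x x0.
  apply: le_trans (ler_norm_sum _ _ _) _.
  apply: (@le_trans _ _ (K * mertens_sum R (fun n => coprime n d && ~~ anti n) x)); last first.
    by rewrite ler_wpM2l //; exact: le_trans (ler_norm _) (hC' x x0).
  rewrite /mertens_sum mulr_sumr (bigID (coprime^~ d)) /= [X in _ + X]big1 ?addr0; last first.
    by move=> n /andP[_ nd]; have [_ -> //] := zu; rewrite mulr0 normr0.
  under [leRHS]eq_bigl => n do rewrite andbC.
  by apply: ler_sum => n _;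
    rewrite normrM ger0_norm ?mertens_term_ge0 // mulrC ler_wpM2r ?mertens_term_ge0.
apply/eqP; rewrite -subr_eq0 opprK; apply/eqP.
apply: bounded_seq_ln;
  apply: eq_bnd (bounded_seqB (bounded_seqB b1 b2) (bounded_seqZ (u m0) bounded_seq_anti)) =>
    x _.
rewrite [X in X + _ - _ - _](bigID anti) /=.
have uA1 m : anti m -> u m = u m0 by move=> am; have := uA m m0 1%N am am0; rewrite !muln1.
rewrite [X in X + _ + _ - _ - _](eq_bigr (fun m => mangoldt R m / m%:R * u m0));
  last by move=> m /uA1 ->.
by rewrite -mulr_suml -/(mertens_sum R anti x) mulrDl mulrBr [_ * u m0]mulrC; ring.
Qed.

Lemma dichotomy m0 g : anti m0 -> coprime g d -> same 1 g || anti g.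
Proof.
move=> am0 gd; have [//|ng /=] := boolP (same 1 g).
have [m0d am0P] := antiP _ am0.
pose u n : R := (same 1 n)%:R - (same g n)%:R.
have zu : mean0_class d u.
  split.
  - by move=> n; rewrite /u !periodic_same.
  - by move=> n nd; rewrite /u /same (negbTE nd) /= subrr.
  - rewrite sumrB -(sum_dilate d0 (f := fun n => (same g n)%:R) _ gd); last first.
      by move=> n; rewrite periodic_same.
    rewrite -sumrB big1 // => n _; apply/eqP; rewrite subr_eq0; apply/eqP.
    congr (nat_of_bool _)%:R; apply/sameP/sameP => -[nd e]; split.
    + by rewrite coprimeMl gd.
    + by move=> h; rewrite -mulnA mulnCA e mul1n.
    + by move: nd; rewrite coprimeMl gd.
    + move=> h; have [k gk] := mod_inverse d0 gd.
      have hE : h = (g * (k * h))%N %[mod d].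
        by rewrite mulnA -modnMml gk modnMml mul1n.
      rewrite mul1n (f_eqmod hE) -e.
      apply: f_eqmod; rewrite -modnMmr hE modnMmr.
      by rewrite -!mulnA [(n * (g * _))%N]mulnCA.
have uA m m' n : anti m -> anti m' -> u (m * n)%N = u (m' * n)%N.
  move=> /antiP[md am] /antiP[m'd am']; rewrite /u.
  have sA g' : same g' (m * n) = same g' (m' * n).
    rewrite /same !coprimeMl md m'd /=; congr (_ && _).
    by apply: eq_forallb => h; rewrite -!mulnA am am'.
  by rewrite !sA.
have := concentrated_sign am0 zu uA; rewrite /u.
have -> : same 1 1.
  by apply/sameP; split=> //; exact: coprime1n.
have -> : same g 1 = false.
  by apply: contraNF ng => /sameP[_ e]; apply/sameP; split.
have -> : same 1 m0 = false.
  apply/negP => /sameP[_ e]; move: (e h0); rewrite am0P mul1n => /eqP.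
  by rewrite eq_sym -subr_eq0 opprK -mulr2n mulrn_eq0 /= (negbTE fh0).
case: (boolP (same g m0)) => [/sameP[_ e] _|_]; last first.
  by rewrite subr0 subr0 => /eqP; rewrite eq_sym oppr_eq0 oner_eq0.
by apply/antiP; split=> // h; rewrite -e am0P.
Qed.

Lemma null_class_false : False.
Proof.
have [m0 am0] := anti_exists; have [m0d am0P] := antiP _ am0.
pose chi n : R := (same 1 n)%:R - (anti n)%:R.
have excl n : same 1 n -> anti n = false.
  move=> /sameP[_ e]; apply/negP => /antiP[_ e']; move: (e h0); rewrite e' mul1n => /eqP.
  by rewrite eq_sym -subr_eq0 opprK -mulr2n mulrn_eq0 /= (negbTE fh0).
have antiE n : anti n = same 1 (m0 * n).
  apply/antiP/sameP => -[nd e].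
    split; first by rewrite coprimeMl m0d.
    by move=> h; rewrite -mulnA am0P e opprK mul1n.
  split; first by move: nd; rewrite coprimeMl m0d.
  by move=> h; move: (e h); rewrite -mulnA am0P mul1n => <-; rewrite opprK.
have zchi : mean0_class d chi.
  split.
  - move=> n; have e : (m0 * (n + d) = m0 * n %[mod d])%N.
      by rewrite mulnDr addnC modnMDl.
    by rewrite /chi !antiE periodic_same (same_eqmod 1 e).
  - by move=> n nd; rewrite /chi /same /anti (negbTE nd) /= subrr.
  - rewrite sumrB -(sum_dilate d0 (f := fun n => (same 1 n)%:R) _ m0d); last first.
      by move=> n; rewrite periodic_same.
    by rewrite -sumrB big1 // => n _; rewrite antiE subrr.
have chi_sign n (a : bool) : coprime n d -> (forall h, f (n * h)%N = (-1) ^+ a * f h) ->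
    chi n = (-1) ^+ a.
  move=> nd; rewrite /chi; case: a => /= [fn|fn].
    have an : anti n by apply/antiP; split=> // h; rewrite fn expr1 mulN1r.
    by rewrite an expr1; case: (boolP (same 1 n)) => [/excl|_]; rewrite ?an // sub0r.
  have sn : same 1 n by apply/sameP; split=> // h; rewrite fn expr0 !mul1r mul1n.
  by rewrite sn (excl _ sn) subr0.
have sign_ex n : coprime n d -> exists a : bool, forall h, f (n * h)%N = (-1) ^+ a * f h.
  move=> nd; case/orP: (dichotomy am0 nd) => [/sameP|/antiP] [_ fn].
    by exists false => h; rewrite fn mul1n mul1r.
  by exists true => h; rewrite fn mulN1r.
have z k : ~~ coprime k d -> chi k = 0 by case: zchi => _ + _; apply.
have chiM m n : chi (m * n)%N = chi m * chi n.
  have [md|md] := boolP (coprime m d); last first.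
    by rewrite (z m) // mul0r z // coprimeMl (negbTE md).
  have [nd|nd] := boolP (coprime n d); last first.
    by rewrite (z n) // mulr0 z // coprimeMl (negbTE nd) andbF.
  have [[a fa] [b fb]] := (sign_ex m md, sign_ex n nd).
  rewrite (chi_sign _ _ md fa) (chi_sign _ _ nd fb) -signr_addb.
  apply: chi_sign => [|h]; first by rewrite coprimeMl md.
  by rewrite -mulnA fa fb mulrA signr_addb.
have chi1 : chi 1%N = 1.
  have s1 : same 1 1 by apply/sameP; split=> //; exact: coprime1n.
  by rewrite /chi s1 (excl _ s1) subr0.
have chi_val n : [\/ chi n = 0, chi n = 1 | chi n = -1].
  rewrite /chi; case: (same 1 n); case: (anti n); rewrite ?subrr ?subr0 ?sub0r.
  - by constructor 1.
  - by constructor 2.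
  - by constructor 3.
  - by constructor 1.
have [D bD] := mean0_class_bounded d0 zchi.
have bchi : bounded_sums D chi by have := bD 1%N; rewrite dilate1.
apply: (real_character_L_neq0 chi1 chiM chi_val bchi).
have <- : Lval chi = 0; last exact: Lval_hlim bchi.
have chiN m : anti m -> chi m = -1.
  move=> /antiP[md fm]; apply: (chi_sign _ true md) => h.
  by rewrite fm mulN1r.
have -> : chi = dilate (dilate chi m0) m0.
  rewrite dilateM; apply/funext => n; rewrite /dilate !chiM (chiN m0) //.
  by rewrite mulrNN mulr1 mul1r.
apply: concentrated => //; first exact: mean0_class_dilate.
by move=> m m' n am am'; rewrite /dilate !chiM (chiN m) // (chiN m').
Qed.

End Nonvanishing.

(** * Dirichlet's theorem *)

Section Equidistribution.
Variables (R : realType) (d : nat).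
Hypothesis d0 : (0 < d)%N.
Implicit Types f g h : nat -> R.

Lemma L_nonvanishing f : mean0_class d f -> (forall m, Lval (dilate f m) = 0) ->
  forall n, f n = 0.
Proof.
move=> zf fL0 n; apply/eqP; apply/negP => /negP fn.
exact: (null_class_false d0 zf fL0 fn).
Qed.

Lemma mean0_class_lin (I : Type) (r : seq I) (c : I -> R) (F : I -> nat -> R) :
  (forall i, mean0_class d (F i)) -> mean0_class d (fun n => \sum_(i <- r) c i * F i n).
Proof.
move=> zF; split.
- by move=> n; apply: eq_bigr => i _; have [-> _ _] := zF i.
- by move=> n nd; rewrite big1 // => i _; have [_ -> //] := zF i; rewrite mulr0.
- rewrite exchange_big big1 // => i _; rewrite -mulr_sumr.
  by have [_ _ ->] := zF i; rewrite mulr0.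
Qed.

Lemma mean0_classD f g : mean0_class d f -> mean0_class d g -> mean0_class d (fun n =>
  f n + g n).
Proof.
move=> [pf cf sf] [pg cg sg]; split.
- by move=> n; rewrite pf pg.
- by move=> n nd; rewrite cf ?cg ?addr0.
- by rewrite big_split /= sf sg addr0.
Qed.

Lemma mean0_classN f : mean0_class d f -> mean0_class d (fun n => - f n).
Proof.
move=> [pf cf sf]; split.
- by move=> n; rewrite pf.
- by move=> n nd; rewrite cf ?oppr0.
- by rewrite sumrN sf oppr0.
Qed.

Lemma mean0_class_Lval f : mean0_class d f -> mean0_class d (fun m => Lval (dilate f m)).
Proof.
move=> zf; have [pf cf sf] := zf; split.
- by move=> n; apply: (Lval_eqmod pf); rewrite addnC modnDl.
- by move=> n nd; exact: (Lval_ncoprime zf).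
- transitivity (Lval (fun n => \sum_(j <- index_enum 'I_d) 1 * dilate f j n)).
    rewrite (Lval_lin d0) => [|j]; last exact: mean0_class_dilate.
    by apply: eq_bigr => j _; rewrite mul1r.
  rewrite (_ : (fun n => _) = fun=> 0) ?Lval0 //; apply/funext => n.
  have [_ _ s] := mean0_class_dilate d0 n zf.
  rewrite -[RHS]s; apply: eq_bigr => j _.
  by rewrite mul1r /dilate mulnC.
Qed.

Let phi : R := \sum_(i < d) (coprime i d)%:R.

Lemma phi_gt0 : 0 < phi.
Proof.
rewrite /phi (bigD1 (Ordinal (ltn_pmod 1 d0))) //= coprime_modl coprime1n.
by rewrite ltr_pwDl // sumr_ge0.
Qed.

Let basis (i : 'I_d) n : R :=
  (coprime n d)%:R * ((n %% d == i)%N%:R - (coprime i d)%:R / phi).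

Lemma mean0_class_basis i : mean0_class d (basis i).
Proof.
split.
- by move=> n; rewrite /basis -coprime_modl addnC modnDl coprime_modl.
- by move=> n nd; rewrite /basis (negbTE nd) mul0r.
- rewrite (eq_bigr (fun n : 'I_d => (coprime n d)%:R * (n == i)%:R -
     (coprime i d)%:R / phi * (coprime n d)%:R)); last first.
    by move=> n _; rewrite /basis mulrBr [in X in _ - X]mulrC modn_small.
  rewrite sumrB -mulr_sumr divfK ?gt_eqF ?phi_gt0 // (bigD1 i) //= eqxx mulr1.
  rewrite big1 ?addr0 ?subrr // => n /negbTE ->; exact: mulr0.
Qed.

(* The projection onto mean-zero functions on the units. *)
Let proj (v : 'I_d -> R) n : R := \sum_(i < d) v i * basis i n.

Lemma mean0_class_proj v : mean0_class d (proj v).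
Proof. by apply: mean0_class_lin => i; exact: mean0_class_basis. Qed.

Lemma proj_id f n : mean0_class d f -> proj (fun i => f i) n = f n.
Proof.
move=> [pf cf sf]; have [nd|nd] := boolP (coprime n d); last first.
  by rewrite cf // /proj big1 // => i _; rewrite /basis (negbTE nd) mul0r mulr0.
rewrite /proj (eq_bigr (fun i : 'I_d => f i * (n %% d == i)%N%:R - f i / phi)); last first.
  move=> i _; rewrite /basis nd mul1r mulrBr; congr (_ - _).
  have [id_|id_] := boolP (coprime i d); first by rewrite mul1r.
  by rewrite cf // !mul0r.
rewrite sumrB -mulr_suml sf mul0r subr0 (bigD1 (Ordinal (ltn_pmod n d0))) //=.
rewrite eqxx mulr1 periodic_mod // big1 ?addr0 // => i /negbTE ni.
rewrite (_ : (n %% d == i)%N = false) ?mulr0 //.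
by apply: contraFF ni => /eqP e; apply/eqP; apply: val_inj.
Qed.

(* The map [f |-> (m |-> Lval (dilate f m))] on mean-zero functions, extended by the
   identity of a complement to an endomorphism of the space of all functions mod [d]. *)
Let A : 'M[R]_d :=
  \matrix_(i, j) ((j == i)%:R - basis i j + Lval (dilate (basis i) j)).

Lemma mul_A (v : 'rV[R]_d) j :
  (v *m A) 0 j = v 0 j - proj (v 0) j + Lval (dilate (proj (v 0)) j).
Proof.
have -> : Lval (dilate (proj (v 0)) j) = \sum_(i < d) v 0 i * Lval (dilate (basis i) j).
  by rewrite -(Lval_lin d0) // => i; apply: mean0_class_dilate => //; exact: mean0_class_basis.
rewrite mxE /proj.
rewrite (eq_bigr (fun i =>
  v 0 i * (j == i)%:R - v 0 i * basis i j + v 0 i * Lval (dilate (basis i) j))).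
  rewrite !big_split /= sumrN (bigD1 j) //= eqxx mulr1 [X in _ + X - _ + _]big1 ?addr0 //.
  by move=> i ij; rewrite eq_sym (negbTE ij) mulr0.
by move=> i _; rewrite mxE mulrDr mulrBr.
Qed.

Lemma solve_A (v : 'rV[R]_d) g : mean0_class d g ->
  (forall j, (v *m A) 0 j = g j) ->
  (forall j : 'I_d, v 0 j = proj (v 0) j) /\
  forall m, Lval (dilate (proj (v 0)) m) = g m.
Proof.
move=> zg vA; set w := fun n => proj (v 0) n + (g n - Lval (dilate (proj (v 0)) n)).
have zw : mean0_class d w.
  apply: mean0_classD; first exact: mean0_class_proj.
  by apply: mean0_classD => //; apply/mean0_classN/mean0_class_Lval/mean0_class_proj.
have vw j : v 0 j = w j.
  by have := mul_A v j; rewrite vA /w => ->; ring.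
have pw n : proj (v 0) n = w n.
  by rewrite -(proj_id n zw); apply: eq_bigr => i _; rewrite vw.
split=> [j|m]; first by rewrite pw vw.
have := pw m; rewrite /w -[X in X = _ -> _]addr0 => /addrI/esym/eqP.
by rewrite subr_eq0 => /eqP.
Qed.

Lemma Lval_surjective g : mean0_class d g ->
  exists2 f, mean0_class d f & forall m, Lval (dilate f m) = g m.
Proof.
move=> zg; have Au : A \in unitmx.
  rewrite -row_free_unit; apply: inj_row_free => v vA.
  have z0 : mean0_class d (fun=> 0 : R) by split=> //; rewrite big1.
  have [|pv pL] := solve_A (v := v) z0; first by move=> j; rewrite vA mxE.
  apply/rowP => j; rewrite mxE pv.
  exact: (L_nonvanishing (mean0_class_proj _) pL).
pose v := (\row_j g j) *m invmx A.
have [|_ pL] := solve_A (v := v) zg; first by move=> j; rewrite mulmxKV // mxE.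
by exists (proj (v 0)) => //; exact: mean0_class_proj.
Qed.

Lemma mertens_sum_class a : coprime a d ->
  bounded_seq (fun x => phi * mertens_sum R (fun n => n == a %[mod d]) x - ln x%:R).
Proof.
move=> ad.
have diff b : coprime b d ->
    bounded_seq (fun x => mertens_sum R (fun n =>
      n == a %[mod d]) x - mertens_sum R (fun n => n == b %[mod d]) x).
  move=> bd; pose g n : R := (n == a %[mod d])%:R - (n == b %[mod d])%:R.
  have sum1 c : \sum_(n < d) (n == c %[mod d])%:R = 1 :> R.
    rewrite (bigD1 (Ordinal (ltn_pmod c d0))) //= modn_mod eqxx big1 ?addr0 // => n nc.
    rewrite (_ : (_ == _) = false) //; apply/negP => /eqP; rewrite modn_small // => e.
    by move/eqP: nc; apply; apply/val_inj.
  have zg : mean0_class d g.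
    split.
    - by move=> n; rewrite /g addnC modnDl.
    - move=> n nd; rewrite /g.
      have h c : coprime c d -> (n == c %[mod d]) = false.
        by move=> cd; apply/negP => /eqP e; move/negP: nd; apply;
          rewrite -coprime_modl e coprime_modl.
      by rewrite !h // subrr.
    - by rewrite sumrB !sum1 subrr.
  have [f zf fL] := Lval_surjective zg.
  have [D bD] := mean0_class_bounded d0 zf; have [C hC] := mangoldt_Lval bD.
  exists C => x _; apply: le_trans (hC x); rewrite le_eqVlt; apply/orP; left; apply/eqP.
  congr `|_|; rewrite /mertens_sum big_mkcond [X in _ - X]big_mkcond /= -sumrB.
  apply: eq_bigr => n _; rewrite fL /g.
  by case: (_ == _); case: (_ == _); rewrite ?subrr ?mulr0 ?subr0 ?sub0r ?mulr1 ?mulrN1.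
have S := bounded_seq_sum (index_enum 'I_d) (P := fun b : 'I_d => coprime b d) (fun b =>
  diff b).
apply: eq_bnd (bounded_seqD S (mertens_sum_coprime R d0)) => x _.
have -> : phi * mertens_sum R (fun n => n == a %[mod d]) x =
    \sum_(b < d | coprime b d) mertens_sum R (fun n => n == a %[mod d]) x.
  rewrite /phi mulr_suml [RHS]big_mkcond; apply: eq_bigr => b _.
  by case: coprime; rewrite ?mul1r ?mul0r.
have -> : mertens_sum R (coprime^~ d) x = \sum_(b < d | coprime b d) mertens_sum R (fun n =>
  n == b %[mod d]) x.
  rewrite /mertens_sum big_mkcond /=.
  rewrite (eq_bigr (fun b : 'I_d => \sum_(1 <= n < x.+1)
    if n == b %[mod d] then mangoldt R n / n%:R else 0)); last by move=> b _;
      rewrite big_mkcond.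
  rewrite exchange_big /=; apply: eq_bigr => n _.
  case: ifP => nd; last first.
    rewrite big1 // => b bd; case: eqP => // e.
    by rewrite -coprime_modl e coprime_modl bd in nd.
  rewrite (bigD1 (Ordinal (ltn_pmod n d0))) /= ?coprime_modl // modn_mod eqxx.
  rewrite big1 ?addr0 // => b /andP[_ bn]; case: eqP => // e.
  by move/eqP: bn => []; apply/val_inj; rewrite /= e modn_small.
by rewrite sumrB; ring.
Qed.

Lemma dirichlet_unbounded a N : coprime a d ->
  exists2 p, prime p & (N < p)%N /\ p = a %[mod d].
Proof.
move=> ad; apply: contrapT => np.
have b : bounded_seq (mertens_sum R (fun n => n == a %[mod d])).
  apply: (@bounded_seq_mertens_sum_sparse _ _ N) => n /eqP na pn; rewrite leqNgt;
    apply/negP => Nn.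
  by apply: np; exists n.
suff : (-1 : R) = 0 by apply/eqP; rewrite oppr_eq0 oner_eq0.
apply: bounded_seq_ln;
  apply: eq_bnd (bounded_seqB (mertens_sum_class ad) (bounded_seqZ phi b)) => x _; ring.
Qed.

End Equidistribution.

Theorem dirichlet (d a N : nat) : (0 < d)%N -> coprime a d ->
  exists2 p, prime p & (N < p)%N /\ p = a %[mod d].
Proof. by move=> d0; exact: (@dirichlet_unbounded Rdefinitions.R). Qed.

(** * The Eisenstein constant and p-adic valuations *)

Section EisensteinConstant.
Variable f : nat -> rat.

Lemma integral_series_gcd (g : rat) (k l : nat) : (0 < k)%N ->
  integral_series (rescale (g * k%:R) f) ->
  integral_series (rescale (g * l%:R) f) ->
  integral_series (rescale (g * (gcdn k l)%:R) f).
Proof.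
move=> k0 hk hl n; move: (hk n) (hl n); rewrite /rescale !exprMn !mulrA.
set a := f n * g ^+ n; rewrite -!natrX => ak al.
have -> : (gcdn k l ^ n = gcdn (k ^ n) (l ^ n))%N.
  have [k' kE] := dvdnP (dvdn_gcdl k l); have [l' lE] := dvdnP (dvdn_gcdr k l).
  have d0 : (0 < gcdn k l)%N by rewrite gcdn_gt0 k0.
  have cop : coprime k' l'.
    rewrite /coprime -(eqn_pmul2r d0) mul1n muln_gcdl.
    by rewrite -kE -lE.
  rewrite [in RHS]kE [in X in gcdn _ (X ^ n)]lE !expnMn -muln_gcdl.
  have /eqP -> : coprime (k' ^ n) (l' ^ n) by rewrite coprimeXl // coprimeXr.
  by rewrite mul1n.
have kn0 : (0 < k ^ n)%N by rewrite expn_gt0 k0.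
case: (egcdnP (l ^ n) kn0) => u v e _.
have -> : (gcdn (k ^ n) (l ^ n))%:R = u%:R * (k ^ n)%:R - v%:R * (l ^ n)%:R :> rat.
  by rewrite -!natrM e natrD addrC addKr.
rewrite mulrBr ![a * (_ * _)]mulrCA; apply: rpredB.
  by rewrite mulr_natl rpredMn.
by rewrite mulr_natl rpredMn.
Qed.

Lemma integral_series_norm c : integral_series (rescale c f) ->
  integral_series (rescale `|c| f).
Proof.
move=> hc n; have := hc n; rewrite /rescale.
case: (ger0P c) => // _; rewrite -[- c]mulN1r exprMn mulrCA => h.
by rewrite rpredM // rpredX // rpredN.
Qed.

Lemma eisenstein_const_exists : f 1%N != 0 -> N_integral f ->
  exists C, is_eisenstein_const f C.
Proof.
move=> f1 [c0 c0n0 hc0].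
set g := `|f 1%N|^-1; have g0 : 0 < g by rewrite invr_gt0 normr_gt0.
have toK c : integral_series (rescale c f) -> exists k : nat, `|c| = g * k%:R.
  move=> /integral_series_norm/(_ 1%N); rewrite /rescale expr1 => h.
  have : `|f 1%N * `|c| | \is a Num.nat by rewrite natr_norm_int.
  move=> /natrP[k]; rewrite normrM normr_id => e; exists k.
  by rewrite -e mulKf // normr_eq0.
pose P k := (0 < k)%N /\ integral_series (rescale (g * k%:R) f).
have [k0 [k00 hk0] k0min] : exists2 k0, P k0 & forall k, P k -> (k0 <= k)%N.
  have [k ck] := toK _ hc0.
  have Pk : P k.
    split; last by rewrite -ck; exact: integral_series_norm.
    rewrite lt0n; apply/eqP => kz; move: ck; rewrite kz mulr0 => /eqP.
    by rewrite normr_eq0 (negbTE c0n0).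
  have exP : exists k, `[< P k >] by exists k; apply/asboolP.
  case: (ex_minnP exP) => m /asboolP Pm mmin.
  by exists m => // j Pj; apply: mmin; apply/asboolP.
exists (g * k0%:R); split; first by rewrite mulr_gt0 // ltr0n.
move=> c; split=> [hc|[k ->] n].
  have [k ck] := toK _ hc.
  have k0k : (k0 %| k)%N.
    have := k0min (gcdn k0 k); move/(_ _)/wrap => [].
      split; first by rewrite gcdn_gt0 k00.
      by apply: integral_series_gcd => //; rewrite -ck; exact: integral_series_norm.
    move=> le; apply/gcdn_idPl/eqP; rewrite eqn_leq le andbT.
    by rewrite dvdn_leq // dvdn_gcdl.
  have [q kq] := dvdnP k0k.
  have cn : `|c| = g * k0%:R * q%:R by rewrite ck kq mulnC natrM mulrA.
  case: (ger0P c) cn => _ cn; first by exists q%:Z.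
  by exists (- q%:Z); rewrite mulrNz mulrN -cn opprK.
rewrite /rescale exprMn mulrA rpredM //; first exact: hk0.
by rewrite rpredX // intr_int.
Qed.

End EisensteinConstant.

Section Valuation.
Variable p : nat.

Lemma absz_num_gt0 (x : rat) : x != 0 -> (0 < `|numq x|)%N.
Proof. by rewrite absz_gt0 numq_eq0. Qed.

Lemma exact_denom_gt0 (x : rat) : (0 < exact_denom x)%N.
Proof. by rewrite absz_gt0 denq_neq0. Qed.

Lemma padic_val_frac (a b : int) : a != 0 -> b != 0 ->
  padic_val p (a%:~R / b%:~R) = (logn p `|a|)%:Z - (logn p `|b|)%:Z.
Proof.
move=> a0 b0; set x := _ / _.
have x0 : x != 0 by rewrite mulf_neq0 ?invr_eq0 ?intr_eq0.
have e : numq x * b = a * denq x.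
  apply/eqP; rewrite -(eqr_int rat) !intrM numqE /x.
  by apply/eqP; rewrite mulrAC divfK ?intr_eq0.
have {}e : (logn p `|numq x| + logn p `|b| = logn p `|a| + logn p (exact_denom x))%N.
  rewrite -!lognM ?absz_num_gt0 ?exact_denom_gt0 ?absz_gt0 //.
  by rewrite -!abszM e.
by rewrite /padic_val; lia.
Qed.

Lemma padic_val_nat n : padic_val p n%:R = logn p n.
Proof.
by rewrite /padic_val /exact_denom pmulrn numq_int denq_int logn1 subr0.
Qed.

Lemma padic_valM x y : x != 0 -> y != 0 ->
  padic_val p (x * y) = padic_val p x + padic_val p y.
Proof.
move=> x0 y0; rewrite -[in LHS](divq_num_den x) -[in LHS](divq_num_den y) mulf_div -!intrM.
rewrite padic_val_frac ?mulf_neq0 ?numq_eq0 ?denq_neq0 // !abszM.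
rewrite !lognM ?absz_num_gt0 ?absz_gt0 ?denq_neq0 //.
by rewrite /padic_val /exact_denom; lia.
Qed.

Lemma padic_val1 : padic_val p 1 = 0.
Proof. by rewrite (padic_val_nat 1) logn1. Qed.

Lemma padic_valV x : x != 0 -> padic_val p x^-1 = - padic_val p x.
Proof.
move=> x0; have xi0 : x^-1 != 0 by rewrite invr_eq0.
have := padic_valM xi0 x0; rewrite mulVf // padic_val1 => e.
by apply/eqP; rewrite -addr_eq0 -e.
Qed.

Lemma padic_valX x n : x != 0 -> padic_val p (x ^+ n) = padic_val p x *+ n.
Proof.
move=> x0; elim: n => [|n IH]; first by rewrite expr0 padic_val1.
by rewrite exprS padic_valM ?expf_neq0 // IH mulrS.
Qed.

Lemma padic_valXz x (k : int) : x != 0 -> padic_val p (x ^ k) = padic_val p x * k.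
Proof.
move=> x0; case: k => n; first by rewrite -exprnP padic_valX // -mulr_natr natz.
rewrite NegzE -exprnN padic_valV ?expf_neq0 // padic_valX // -mulr_natr natz; ring.
Qed.

Lemma padic_val_prod (I : eqType) (r : seq I) (F : I -> rat) :
  {in r, forall i, F i != 0} ->
  padic_val p (\prod_(i <- r) F i) = \sum_(i <- r) padic_val p (F i).
Proof.
elim: r => [|i r IH] h; first by rewrite !big_nil padic_val1.
have hr : {in r, forall i, F i != 0} by move=> j jr; apply: h; rewrite inE jr orbT.
rewrite !big_cons padic_valM ?IH ?h ?inE ?eqxx //.
by rewrite prodf_seq_neq0; apply/allP => j jr /=; exact: hr.
Qed.

End Valuation.

Lemma int_of_padic_val x : (forall p, prime p -> 0 <= padic_val p x) ->
  x \is a Num.int.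
Proof.
move=> h; rewrite Qint_def; apply/contraT => d1.
have dgt1 : (1 < exact_denom x)%N.
  rewrite ltn_neqAle exact_denom_gt0 andbT eq_sym; apply: contra d1 => /eqP e.
  by rewrite -[denq x]gez0_abs ?denq_ge0 // -/(exact_denom x) e.
have pp := pdiv_prime dgt1; have := h _ pp; set p := pdiv _ in pp *.
have pd : (p %| exact_denom x)%N by exact: pdiv_dvd.
have : (logn p `|numq x| = 0)%N.
  apply/eqP; rewrite -leqn0 leqNgt logn_gt0 mem_primes; apply/negP => /and3P[_ _ pn].
  have := dvdn_gcd p `|numq x| `|denq x|; rewrite pn pd.
  have /eqP -> := coprime_num_den x.
  by rewrite dvdn1 (gtn_eqF (prime_gt1 pp)).
have : (0 < logn p (exact_denom x))%N by rewrite logn_gt0 mem_primes pp exact_denom_gt0.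
by rewrite /padic_val; lia.
Qed.

Lemma padic_val_int p x : x \is a Num.int -> 0 <= padic_val p x.
Proof.
by rewrite Qint_def /padic_val /exact_denom => /eqP ->; rewrite logn1 subr0.
Qed.

(** * Valuations of Pochhammer symbols *)

Lemma count_linear_block (a v M i : nat) : (0 < M)%N -> coprime v M ->
  (\sum_(i <= k < i + M) (a == k * v %[mod M]) = 1)%N.
Proof.
move=> M0 vM; pose h (k : 'I_M) : 'I_M := Ordinal (ltn_pmod ((k + i) * v) M0).
have hinj : injective h.
  move=> k l /(congr1 val) /= e; apply/val_inj => /=.
  have := @mod_mul_inj M M0 v k l vM (ltn_ord k) (ltn_ord l); apply.
  apply/eqP; rewrite -(eqn_modDr (i * v)) ![(v * _)%N]mulnC -!mulnDl.
  exact/eqP.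
rewrite -[i in X in index_iota X _]add0n big_addn addKn big_mkord.
transitivity (\sum_(j < M) nat_of_bool (Ordinal (ltn_pmod a M0) == j))%N.
  by rewrite [RHS](reindex_inj hinj).
rewrite (bigD1 (Ordinal (ltn_pmod a M0))) //= eqxx big1 // => k.
by rewrite eq_sym => /negbTE ->.
Qed.

Lemma count_linear (a v M q : nat) : (0 < M)%N -> coprime v M ->
  (\sum_(0 <= k < q * M) (a == k * v %[mod M]) = q)%N.
Proof.
move=> M0 vM; elim: q => [|q IH]; first by rewrite big_geq.
rewrite mulSn addnC (@big_cat_nat _ _ _ (q * M)) ?leq_addr //=.
by rewrite IH count_linear_block // addn1.
Qed.

Lemma count_linear_le1 (a v M n : nat) : (0 < M)%N -> coprime v M -> (n <= M)%N ->
  (\sum_(0 <= k < n) (a == k * v %[mod M]) <= 1)%N.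
Proof.
move=> M0 vM nM; rewrite -(count_linear_block a 0 M0 vM) add0n.
by rewrite [X in (_ <= X)%N](@big_cat_nat _ _ _ n) //= leq_addr.
Qed.

Lemma logn_sum (p m B : nat) : prime p -> (0 < m)%N -> (logn p m <= B)%N ->
  (logn p m = \sum_(1 <= l < B.+1) (p ^ l %| m))%N.
Proof.
move=> pp m0 mB; rewrite (eq_bigr (fun l => nat_of_bool (l <= logn p m)%N)); last first.
  by move=> l _; rewrite pfactor_dvdn.
rewrite (@big_cat_nat _ _ _ (logn p m).+1) //=.
rewrite [X in (_ + X)%N]big_nat_cond [X in (_ + X)%N]big1 ?addn0; last first.
  by move=> l /andP[/andP[h _] _]; rewrite leqNgt h.
rewrite big_nat_cond (eq_bigr (fun=> 1%N)); last by move=> l /andP[/andP[_ h] _];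
  rewrite -ltnS h.
by rewrite -big_nat_cond sum_nat_const_nat muln1 subn1.
Qed.

Section PochhammerValuation.
Variable p : nat.

Definition geom L : nat := (\sum_(0 <= l < L) p ^ l)%N.

Definition numval (x : rat) (n : nat) : nat :=
  (\sum_(k < n) logn p `|(numq x + k%:Z * denq x)%R|)%N.

Lemma param_shift_neq0 x (k : nat) : is_param x -> x + k%:R != 0.
Proof.
apply: contra; rewrite addr_eq0 => /eqP ->.
by rewrite rpredN ?rpred_nat //= oppr_le0 ler0n.
Qed.

Lemma poch_neq0 x n : is_param x -> poch x n != 0.
Proof.
by move=> px; rewrite /poch prodf_seq_neq0; apply/allP => k _ /=; exact: param_shift_neq0.
Qed.

Lemma shiftE x (k : nat) : x + k%:R = (numq x + k%:Z * denq x)%:~R / (denq x)%:~R.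
Proof.
rewrite rmorphD rmorphM /= mulrDl mulfK ?intr_eq0 ?denq_neq0 // divq_num_den.
by rewrite pmulrn.
Qed.

Lemma num_shift_neq0 x (k : nat) : is_param x -> numq x + k%:Z * denq x != 0.
Proof.
move=> px; have := param_shift_neq0 k px; rewrite shiftE; apply: contraNneq => ->.
by rewrite mul0r.
Qed.

Lemma padic_val_poch x n : is_param x ->
  padic_val p (poch x n) = (numval x n)%:Z - (n * logn p (exact_denom x))%N%:Z.
Proof.
move=> px; rewrite /poch padic_val_prod; last by move=> k _; exact: param_shift_neq0.
rewrite (eq_bigr (fun k : 'I_n => (logn p `|numq x + k%:Z * denq x|)%:Z -
   (logn p (exact_denom x))%:Z)); last first.
  by move=> k _; rewrite shiftE padic_val_frac ?denq_neq0 ?num_shift_neq0.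
rewrite sumrB sumr_const card_ord /numval; congr (_ - _).
  by rewrite (big_morph Posz PoszD (erefl _)).
by rewrite -mulr_natl PoszM natz.
Qed.

Lemma in_ZpE x : prime p -> in_Zp p x = ~~ (p %| exact_denom x)%N.
Proof.
move=> pp; rewrite /in_Zp /padic_val; have [pd|pd] := boolP (p %| exact_denom x)%N.
  have ld : (0 < logn p (exact_denom x))%N by rewrite logn_gt0 mem_primes pp exact_denom_gt0.
  have : (logn p `|numq x| = 0)%N.
    apply/eqP; rewrite -leqn0 leqNgt logn_gt0 mem_primes; apply/negP => /and3P[_ _ pn].
    have := dvdn_gcd p `|numq x| `|denq x|; rewrite pn pd.
    have /eqP -> := coprime_num_den x.
    by rewrite dvdn1 (gtn_eqF (prime_gt1 pp)).
  by move=> ->; apply/negbTE; rewrite -ltNge; lia.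
by rewrite [logn p (exact_denom x)]lognE pp exact_denom_gt0 (negbTE pd) subr0.
Qed.

Hypothesis pp : prime p.

Lemma numval_notin x n : ~~ in_Zp p x -> numval x n = 0%N.
Proof.
rewrite in_ZpE // negbK => pd; rewrite /numval big1 // => k _.
apply/eqP; rewrite -leqn0 leqNgt logn_gt0 mem_primes; apply/negP => /and3P[_ _ pn].
have : (p%:Z %| numq x)%Z.
  by rewrite -[numq x](addrK (k%:Z * denq x)) rpredB // dvdz_mull.
rewrite dvdzE /= => pn'.
have := dvdn_gcd p `|numq x| `|denq x|; rewrite pn' pd.
have /eqP -> := coprime_num_den x.
by rewrite dvdn1 (gtn_eqF (prime_gt1 pp)).
Qed.

Lemma geomE L : (geom L * p.-1 + 1 = p ^ L)%N.
Proof.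
have p1 := prime_gt0 pp.
elim: L => [|L IH]; first by rewrite /geom big_geq // expn0.
rewrite /geom big_nat_recr //= mulnDl addnAC -/(geom L) IH -mulnS prednK //.
by rewrite expnS mulnC.
Qed.

Definition neg_num (x : rat) (M : nat) : nat := `|((- numq x) %% M)%Z|%N.

Lemma dvd_num_shift x M k : (0 < M)%N ->
  (M %| `|(numq x + k%:Z * denq x)%R|)%N = (neg_num x M == k * exact_denom x %[mod M]).
Proof.
move=> M0; have M0' : M%:Z != 0 by lia.
rewrite -[in LHS](absz_nat M) -dvdzE.
rewrite -[numq x]opprK addrC -eqz_mod_dvd eq_sym.
have e : (- numq x = (neg_num x M)%:Z %[mod M])%Z.
  by rewrite /neg_num gez0_abs ?modz_ge0 // modz_mod.
rewrite e; have -> : denq x = (exact_denom x)%:Z by rewrite /exact_denom gez0_abs ?denq_ge0.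
by rewrite -PoszM !modz_nat.
Qed.

Lemma numval_bounds x L : is_param x -> in_Zp p x ->
  (geom L <= numval x (p ^ L) <= geom L + (`|numq x| + exact_denom x))%N.
Proof.
move=> px; rewrite in_ZpE // => pd; have p0 := prime_gt0 pp.
set K := (`|numq x| + exact_denom x)%N.
have numE : numval x (p ^ L) =
  (\sum_(1 <= l < (L + K).+1) \sum_(0 <= k < p ^ L) (neg_num x (p ^ l) == k * exact_denom x
    %[mod p ^ l]))%N.
  rewrite exchange_big_nat /= big_mkord; apply: eq_bigr => k _.
  have m0 : (0 < `|(numq x + k%:Z * denq x)%R|)%N by rewrite absz_gt0 num_shift_neq0.
  rewrite (logn_sum (B := L + K) pp m0).
    by apply: eq_bigr => l _; rewrite dvd_num_shift // expn_gt0 p0.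
  rewrite -(leq_exp2l _ _ (prime_gt1 pp)); apply: (leq_trans (dvdn_leq m0 (pfactor_dvdnn p _))).
  rewrite expnD; apply: (@leq_trans (p ^ L * K)); last first.
    by rewrite leq_mul2l ltnW ?orbT // ltn_expl // prime_gt1.
  have kL := ltn_ord k; have pL : (0 < p ^ L)%N by rewrite expn_gt0 p0.
  have dE : denq x = (exact_denom x)%:Z by rewrite /exact_denom gez0_abs ?denq_ge0.
  apply: (@leq_trans (`|numq x| + k * exact_denom x)); first by rewrite dE -PoszM; lia.
  rewrite /K mulnDr.
  by rewrite leq_add ?leq_pmull // leq_mul2r ltnW ?orbT.
have cop l : coprime (exact_denom x) (p ^ l).
  by rewrite coprime_sym coprimeXl // prime_coprime.
have pl0 l : (0 < p ^ l)%N by rewrite expn_gt0 p0.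
have headE : (\sum_(1 <= l < L.+1) \sum_(0 <= k < p ^ L) (neg_num x (p ^ l) == k *
  exact_denom x %[mod p ^ l]) = geom L)%N.
  rewrite /geom [RHS]big_nat_rev /= big_add1 /=.
  apply: eq_big_nat => l /andP[_ lL]; rewrite add0n.
  have -> : (p ^ L = p ^ (L - l.+1) * p ^ l.+1)%N by rewrite -expnD subnK.
  by rewrite count_linear.
rewrite numE (@big_cat_nat _ _ _ L.+1) //=; last by rewrite ltnS leq_addr.
rewrite headE leq_addr leq_add2l /=.
apply: (@leq_trans (\sum_(L.+1 <= l < (L + K).+1) 1)).
  rewrite big_nat_cond [X in (_ <= X)%N]big_nat_cond; apply: leq_sum => l /andP[/andP[Ll _] _].
  by rewrite count_linear_le1 // leq_exp2l ?prime_gt1 // ltnW.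
by rewrite sum_nat_const_nat muln1 subSS addKn.
Qed.

Lemma sum_numval_le (s : seq rat) : {in s, forall x, is_param x} ->
  exists K, forall L, (\sum_(x <- s) numval x (p ^ L) <= count (in_Zp p) s * geom L + K)%N.
Proof.
elim: s => [|x s IH] h; first by exists 0%N => L; rewrite big_nil.
have hs : {in s, forall x, is_param x} by move=> y ys; apply: h; rewrite inE ys orbT.
have [K hK] := IH hs; have px : is_param x by apply: h; rewrite inE eqxx.
exists (`|numq x| + exact_denom x + K)%N => L; rewrite big_cons /=.
have := hK L; have [xZ|xZ] := boolP (in_Zp p x).
  by have /andP[_] := numval_bounds L px xZ; lia.
by rewrite numval_notin //; lia.
Qed.

Lemma sum_numval_ge (s : seq rat) L : {in s, forall x, is_param x} ->
  (count (in_Zp p) s * geom L <= \sum_(x <- s) numval x (p ^ L))%N.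
Proof.
elim: s => [|x s IH] h; first by rewrite big_nil.
have hs : {in s, forall x, is_param x} by move=> y ys; apply: h; rewrite inE ys orbT.
have := IH hs; have px : is_param x by apply: h; rewrite inE eqxx.
rewrite big_cons /=; have [xZ|xZ] := boolP (in_Zp p x); last by lia.
by have /andP[+ _] := numval_bounds L px xZ; lia.
Qed.

End PochhammerValuation.

Section Hypergeometric.
Variables alpha beta : seq rat.
Hypothesis Halpha : {in alpha, forall a, is_param a}.
Hypothesis Hbeta : {in beta, forall b, is_param b}.

Definition denom_val p : int :=
  (\sum_(a <- alpha) logn p (exact_denom a))%N%:Z -
  (\sum_(b <- beta) logn p (exact_denom b))%N%:Z.

Lemma prod_poch_neq0 (s : seq rat) n : {in s, forall x, is_param x} ->
  \prod_(x <- s) poch x n != 0.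
Proof.
by move=> h; rewrite prodf_seq_neq0; apply/allP => x xs /=; apply/poch_neq0/h.
Qed.

Lemma hypergeom_neq0 n : hypergeom alpha beta n != 0.
Proof. by rewrite mulf_neq0 ?invr_eq0 ?prod_poch_neq0. Qed.

Lemma padic_val_prod_poch p (s : seq rat) n : {in s, forall x, is_param x} ->
  padic_val p (\prod_(x <- s) poch x n) =
  (\sum_(x <- s) numval p x n)%N%:Z - n%:Z * (\sum_(x <- s) logn p (exact_denom x))%N%:Z.
Proof.
move=> h; rewrite padic_val_prod; last by move=> x xs; apply/poch_neq0/h.
rewrite (eq_big_seq (fun x => (numval p x n)%:Z - n%:Z * (logn p (exact_denom x))%:Z)).
  by rewrite sumrB -mulr_sumr !(big_morph Posz PoszD (erefl _)).
by move=> x xs; rewrite padic_val_poch ?h // PoszM.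
Qed.

Lemma padic_val_hypergeom p n : padic_val p (hypergeom alpha beta n) =
  (\sum_(a <- alpha) numval p a n)%N%:Z - (\sum_(b <- beta) numval p b n)%N%:Z
   - n%:Z * denom_val p.
Proof.
rewrite /hypergeom padic_valM ?invr_eq0 ?prod_poch_neq0 // padic_valV ?prod_poch_neq0 //.
by rewrite !padic_val_prod_poch // /denom_val; ring.
Qed.

Lemma integral_rescaleP c : c != 0 ->
  integral_series (rescale c (hypergeom alpha beta)) <->
  forall p n, prime p ->
    0 <= (\sum_(a <- alpha) numval p a n)%N%:Z - (\sum_(b <- beta) numval p b n)%N%:Z
       + n%:Z * (padic_val p c - denom_val p).
Proof.
move=> c0.
have vE p n : padic_val p (rescale c (hypergeom alpha beta) n) =
    (\sum_(a <- alpha) numval p a n)%N%:Z - (\sum_(b <- beta) numval p b n)%N%:Z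
       + n%:Z * (padic_val p c - denom_val p).
  rewrite /rescale padic_valM ?hypergeom_neq0 ?expf_neq0 // padic_valX //.
  by rewrite padic_val_hypergeom -mulr_natl natz; ring.
split=> [h p n pp|h n]; first by rewrite -vE padic_val_int.
by apply: int_of_padic_val => p pp; rewrite vE h.
Qed.

Lemma floor_le_of_growth p (e : int) : prime p ->
  (forall n, 0 <= (\sum_(a <- alpha) numval p a n)%N%:Z -
     (\sum_(b <- beta) numval p b n)%N%:Z + n%:Z * e) ->
  - Num.floor ((lambda p alpha beta)%:~R / (p%:R - 1) : rat) <= e.
Proof.
move=> pp h; have p1 := prime_gt1 pp.
have p1r : 0 < p%:R - 1 :> rat by rewrite subr_gt0 ltr1n.
rewrite lerNl floor_ge_int ler_pdivlMr // mulrNz mulNr lerNl -subr_ge0 opprK.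
have -> : e%:~R * (p%:R - 1) + (lambda p alpha beta)%:~R =
    (e * (p%:Z - 1) + lambda p alpha beta)%:~R :> rat.
  by move: (lambda p alpha beta) => l; rewrite intrD intrM intrB -pmulrn.
rewrite ler0z leNgt; apply/negP => neg.
have [K hK] := sum_numval_le pp Halpha.
pose L := (K + `|e|).+1.
have geL : (L <= geom p L)%N.
  rewrite /geom -[leqLHS]subn0 -[leqLHS]muln1 -sum_nat_const_nat.
  by apply: leq_sum => l _; rewrite expn_gt0 prime_gt0.
have ge := geomE pp L; have := h (p ^ L)%N.
have := hK L; have := sum_numval_ge pp L Hbeta; move: neg; rewrite /lambda.
rewrite -{}ge; move: geL; rewrite /L; set G := geom p _.
move: G (\sum_(a <- alpha) _)%N (\sum_(b <- beta) _)%N (count _ alpha) (count _ beta).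
move=> G a b cA cB GL neg hb ha h0.
have : (cA%:Z - cB%:Z) * G%:Z <= (- 1 - e * (p%:Z - 1)) * G%:Z.
  by rewrite ler_wpM2r //; lia.
have pE : p.-1%:Z = p%:Z - 1 by lia.
move: h0 hb ha; rewrite PoszD PoszM pE; nia.
Qed.

End Hypergeometric.

(** * Counting in residue classes *)

Section NaturalCounts.
Local Open Scope nat_scope.

Lemma count_linear_from (a v M q i : nat) : 0 < M -> coprime v M ->
  \sum_(i <= k < i + q * M) (a == k * v %[mod M]) = q.
Proof.
move=> M0 vM; elim: q => [|q IH]; first by rewrite addn0 big_geq.
rewrite mulSn [M + _]addnC addnA (@big_cat_nat _ _ _ (i + q * M)) ?leq_addr //=.
by rewrite IH count_linear_block // addn1.
Qed.

Lemma sum_residue_class (d u n : nat) (F : nat -> nat) : 0 < u <= d ->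
  \sum_(1 <= i < (n * d).+1) (i == u %[mod d]) * F i = \sum_(k < n) F (u + k * d).
Proof.
case/andP=> u0 ud; have d0 : 0 < d by exact: leq_trans ud.
elim: n => [|n IH]; first by rewrite mul0n big_geq // big_ord0.
rewrite big_ord_recr /= -IH mulSn [d + _]addnC -addSn.
rewrite (@big_cat_nat _ _ _ (n * d).+1) ?leq_addr //=; congr (_ + _).
have uin : u + n * d \in index_iota (n * d).+1 ((n * d).+1 + d) by rewrite mem_index_iota; lia.
rewrite (big_rem _ uin) /= [u + n * d]addnC modnMDl eqxx mul1n big_seq big1 ?addn0 // => i.
rewrite mem_rem_uniq ?iota_uniq // inE mem_index_iota => /andP[iu /andP[il ir]].
case: eqP => // e; exfalso; move/eqP: iu; apply.
have : (i - (n * d).+1) %% d = (u - 1) %% d.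
  apply/eqP; rewrite -(eqn_modDr ((n * d).+1)) subnK //.
  have -> : u - 1 + (n * d).+1 = n * d + u by lia.
  by rewrite modnMDl; exact/eqP.
by rewrite !modn_small; lia.
Qed.

Lemma sum_multiples (q N : nat) (F : nat -> nat) : 0 < q ->
  \sum_(1 <= i < N.+1) (q %| i) * F i = \sum_(1 <= j < (N %/ q).+1) F (q * j).
Proof.
move=> q0; elim: N => [|N IH]; first by rewrite div0n !big_geq.
rewrite big_nat_recr //= IH divnS //; case: (boolP (q %| N.+1)) => [qN|qN].
  rewrite add1n [RHS]big_nat_recr //= mul1n; congr (_ + F _).
  by rewrite -[LHS](divnK qN) mulnC divnS // qN.
by rewrite mul0n add0n addn0.
Qed.

Lemma sum_multiples0 (q N : nat) (F : nat -> nat) : 0 < q ->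
  \sum_(0 <= c < N * q | q %| c) F c = \sum_(0 <= c < N) F (q * c).
Proof.
move=> q0; elim: N => [|N IH]; first by rewrite mul0n !big_geq.
rewrite mulSn addnC (@big_cat_nat _ _ _ (N * q)) ?leq_addr //= IH [RHS]big_nat_recr //=.
congr (_ + _); rewrite big_mkcond /=.
have Nin : N * q \in index_iota (N * q) (N * q + q) by rewrite mem_index_iota; lia.
rewrite (big_rem _ Nin) /= dvdn_mull // [N * q]mulnC big_seq big1 ?addn0 // => c.
rewrite mem_rem_uniq ?iota_uniq // inE mem_index_iota => /andP[cN /andP[c1 c2]].
case: ifP => // /dvdnP[k cE]; exfalso; move: cN c1 c2; rewrite cE [k * q]mulnC.
rewrite [_ + q]addnC -mulnS eqn_pmul2l // leq_pmul2l // ltn_pmul2l //; lia.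
Qed.

Lemma modn_eq_mul (a b k q : nat) : 0 < k -> (k * a == k * b %[mod k * q]) = (a == b %[mod q]).
Proof. by move=> k0; rewrite -!muln_modr eqn_pmul2l. Qed.

Lemma count_pfactor (p g e q j w : nat) : prime p -> ~~ (p %| w) ->
  \sum_(0 <= c < q * p ^ e) (j == c * (p ^ g * w) %[mod p ^ (g + e)]) = q * (p ^ g %| j).
Proof.
move=> pp pw; have p0 := prime_gt0 pp; have pg0 : 0 < p ^ g by rewrite expn_gt0 p0.
have [/dvdnP[j' ->]|pj] := boolP (p ^ g %| j).
  rewrite muln1 -[RHS](@count_linear j' w (p ^ e) q) ?expn_gt0 ?p0 //; last first.
    by rewrite coprime_sym coprimeXl // prime_coprime.
  apply: eq_bigr => c _; congr nat_of_bool.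
  by rewrite mulnCA [j' * _]mulnC expnD modn_eq_mul.
rewrite muln0 big1 // => c _; case: eqP => // e1; exfalso; move/negP: pj; apply.
have h : p ^ g %| p ^ (g + e) by rewrite dvdn_exp2l // leq_addr.
rewrite /dvdn -(modn_dvdm j h) e1 modn_dvdm //.
by rewrite -/(dvdn _ _) mulnCA dvdn_mulr.
Qed.

Lemma coprime_prime_power (p f c : nat) : prime p -> 0 < f -> coprime c (p ^ f) = ~~ (p %| c).
Proof. by move=> pp f0; rewrite coprime_sym coprime_pexpl // prime_coprime. Qed.

Lemma count_pfactor_unit (p f g j w : nat) : prime p -> ~~ (p %| w) -> g < f ->
  \sum_(0 <= c < p ^ f | coprime c (p ^ f)) (j == c * (p ^ g * w) %[mod p ^ f])
    + p ^ g * (p ^ g.+1 %| j) = p ^ g * (p ^ g %| j).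
Proof.
move=> pp pw gf; have p0 := prime_gt0 pp.
have f0 : 0 < f by exact: leq_ltn_trans gf.
have e1 : p ^ f = p ^ g * p ^ (f - g) by rewrite -expnD subnKC // ltnW.
have := @count_pfactor p g (f - g) (p ^ g) j w pp pw.
rewrite -e1 subnKC 1?ltnW // => <-.
rewrite [RHS](bigID (fun c => coprime c (p ^ f))) /=; congr (_ + _).
rewrite -(@count_pfactor p g.+1 (f - g.+1) (p ^ g) j w) // subnKC // -expnD.
have -> : g + (f - g.+1) = f.-1 by lia.
have pf : p ^ f = p ^ f.-1 * p by rewrite -expnSr prednK.
rewrite [RHS](eq_bigl (dvdn p)) => [|c]; last by rewrite coprime_prime_power // negbK.
rewrite [in RHS]pf (sum_multiples0 _ (fun c => j == c * (p ^ g * w) %[mod p ^ f.-1 * p])) //.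
rewrite -pf; apply: eq_bigr => c _; congr (nat_of_bool (_ == _ %[mod _])).
by rewrite expnS; lia.
Qed.

(** * Christol's criterion *)

Definition class_count (d c m u : nat) : nat := \sum_(1 <= j < m.+1) (j == c * u %[mod d]).

Definition common_num (d : nat) (x : rat) : nat := `|numq x| * (d %/ exact_denom x).

Section CommonNumerator.
Variables (d : nat) (x : rat).
Hypothesis d0 : 0 < d.
Hypothesis xd : exact_denom x %| d.
Hypothesis x01 : (0 < x <= 1)%R.

Lemma cofactor_gt0 : 0 < d %/ exact_denom x.
Proof. by rewrite divn_gt0 ?exact_denom_gt0 // dvdn_leq. Qed.

Lemma numqE_abs : numq x = Posz `|numq x|.
Proof. by case/andP: x01 => x0 _; rewrite gez0_abs // numq_ge0 ltW. Qed.

Lemma denqE_abs : denq x = Posz (exact_denom x).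
Proof. by rewrite /exact_denom gez0_abs ?denq_ge0. Qed.

Lemma common_num_bounds : 0 < common_num d x <= d.
Proof.
case/andP: x01 => x0 x1; rewrite /common_num muln_gt0 cofactor_gt0 andbT.
have n0 : 0 < `|numq x| by rewrite absz_gt0 numq_eq0 gt_eqF.
rewrite n0 /= -[X in _ <= X](divnK xd) mulnC leq_mul2l; apply/orP; right.
have : (numq x <= denq x)%R.
  by rewrite -(ler_int rat) numqE ler_piMl // ler0z denq_ge0.
by rewrite denqE_abs numqE_abs.
Qed.

Lemma common_num_shift k : common_num d x + k * d =
  d %/ exact_denom x * `|(numq x + k%:Z * denq x)%R|.
Proof.
have -> : `|(numq x + k%:Z * denq x)%R| = `|numq x| + k * exact_denom x.
  by rewrite denqE_abs [in LHS]numqE_abs; lia.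
by rewrite /common_num -[X in k * X](divnK xd) mulnDr mulnC; congr (_ + _); rewrite mulnCA.
Qed.

Lemma num_shift_gt0 (k : nat) : 0 < `|(numq x + k%:Z * denq x)%R|.
Proof.
rewrite lt0n; apply/eqP => e; have := common_num_shift k; rewrite e muln0.
by have /andP[] := common_num_bounds; lia.
Qed.

Lemma logn_cofactor p : prime p -> in_Zp p x -> logn p (d %/ exact_denom x) = logn p d.
Proof.
move=> pp; rewrite in_ZpE // => pd.
rewrite -[in RHS](divnK xd) lognM ?cofactor_gt0 ?exact_denom_gt0 //.
by rewrite [logn p (exact_denom x)]lognE pp exact_denom_gt0 (negbTE pd) addn0.
Qed.

Lemma numval_class_count p c n m : prime p -> d < p -> n <= p -> n * d %/ p = m ->
  p * c = 1 %[mod d] -> numval p x n = class_count d c m (common_num d x).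
Proof.
move=> pp dp np mE pc; have p0 := prime_gt0 pp.
have [u0 ud] := andP common_num_bounds; set u := common_num d x in u0 ud *.
have cop_pd : coprime p d by rewrite prime_coprime // gtnNdvd.
have -> : numval p x n = \sum_(1 <= i < (n * d).+1) (i == u %[mod d]) * (p %| i).
  rewrite sum_residue_class ?u0 //; apply: eq_bigr => k _.
  rewrite common_num_shift // Gauss_dvdr; last first.
    rewrite prime_coprime // gtnNdvd ?cofactor_gt0 //.
    exact: leq_ltn_trans (leq_div _ _) dp.
  set m1 := `|_|; have m10 : 0 < m1 by exact: num_shift_gt0.
  have m1p : m1 < p ^ 2.
    apply: (@leq_ltn_trans (u + k * d)).
      by rewrite common_num_shift // leq_pmull // cofactor_gt0.
    apply: (@leq_ltn_trans (p * d)); last by rewrite expnS expn1 ltn_pmul2l.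
    apply: (@leq_trans (n * d)); last by rewrite leq_mul2r np orbT.
    by have := ltn_ord k; nia.
  rewrite (logn_sum (B := 1) pp m10) ?big_nat1 ?expn1 //.
  rewrite leqNgt -pfactor_dvdn //; apply/negP => /(dvdn_leq m10).
  by rewrite leqNgt m1p.
under eq_bigr => i _ do rewrite mulnC.
rewrite sum_multiples // mE; apply: eq_bigr => j _; congr nat_of_bool.
apply/eqP/eqP => e.
  by rewrite -modnMmr -e modnMmr mulnA [c * p]mulnC -modnMml pc modnMml mul1n.
by rewrite -modnMmr e modnMmr mulnA -modnMml pc modnMml mul1n.
Qed.

End CommonNumerator.

Lemma class_count_period d c q m u : 0 < d ->
  class_count d c (q * d + m) u = q + class_count d c m u.
Proof.
move=> d0; rewrite /class_count (@big_cat_nat _ _ _ (q * d).+1) //=; last first.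
  by rewrite ltnS leq_addr.
congr (_ + _).
  rewrite -[RHS](@count_linear_from (c * u) 1 d q 1 d0 (coprime1n d)) add1n.
  by apply: eq_bigr => j _; rewrite muln1 eq_sym.
rewrite -add1n big_addn (_ : (q * d + m).+1 - q * d = m.+1); last by lia.
by apply: eq_bigr => j _; rewrite addnC modnMDl.
Qed.

Lemma ceil_div_bounds a d : 0 < d -> a <= (a + d.-1) %/ d * d < a + d.
Proof.
move=> d0; have := ltn_pmod (a + d.-1) d0; have := divn_eq (a + d.-1) d.
by move: (_ %/ _ * _) (_ %% _) => x y; lia.
Qed.

Section Christol.
Variables alpha beta : seq rat.
Hypothesis sz : size alpha = size beta.
Hypothesis Ha : {in alpha, forall a, 0 < a <= 1}%R.
Hypothesis Hb : {in beta, forall b, 0 < b <= 1}%R.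

Let d := lcm_denom alpha beta.

Lemma lcm_denom_gt0 : 0 < d.
Proof.
rewrite /d /lcm_denom; elim/big_ind: _ => // [m n m0 n0|x _]; first by rewrite lcmn_gt0 m0.
exact: exact_denom_gt0.
Qed.

Lemma dvdn_lcm_denom x : x \in alpha ++ beta -> exact_denom x %| d.
Proof. by move=> xs; rewrite /d /lcm_denom (big_rem x) //= dvdn_lcml. Qed.

Lemma param01 (x : rat) : (0 < x <= 1)%R -> is_param x.
Proof. by case/andP=> x0 _; rewrite /is_param negb_and -ltNge x0 orbT. Qed.

Hypothesis HF : N_integral (hypergeom alpha beta).

Lemma christol c m : coprime c d ->
  \sum_(b <- beta) class_count d c m (common_num d b) <=
  \sum_(a <- alpha) class_count d c m (common_num d a).
Proof.
move=> cd; have d0 := lcm_denom_gt0.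
have [c0 c0n hc0] := HF.
rewrite (divn_eq m d); set q := m %/ d; set m0 := m %% d.
have m0d : m0 < d by rewrite ltn_pmod.
have ccE (t : seq rat) : \sum_(x <- t) class_count d c (q * d + m0) (common_num d x) =
    size t * q + \sum_(x <- t) class_count d c m0 (common_num d x).
  rewrite (eq_bigr (fun x => q + class_count d c m0 (common_num d x))).
    by rewrite big_split /= big_const_seq count_predT iter_addn_0 mulnC.
  by move=> x _; rewrite class_count_period.
rewrite !ccE sz leq_add2l.
have [c' cc'] := mod_inverse d0 cd.
have c'd : coprime c' d.
  have : coprime (c * c') d by rewrite -coprime_modl cc' coprime_modl coprime1n.
  by rewrite coprimeMl => /andP[].
have [p pp [pN pc']] := dirichlet (d + `|numq c0| + exact_denom c0) d0 c'd.
have dp : d < p by lia.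
have val_c0 : padic_val p c0 = 0.
  have nd k : 0 < k -> k < p -> logn p k = 0.
    by move=> k0 kp; rewrite lognE pp k0 gtnNdvd.
  rewrite /padic_val !nd ?exact_denom_gt0 ?absz_num_gt0 //; lia.
have dval : denom_val alpha beta p = 0.
  rewrite /denom_val !big_seq !big1 // => x xs;
    rewrite lognE pp exact_denom_gt0 gtnNdvd ?exact_denom_gt0 //;
  by apply: leq_ltn_trans dp; rewrite dvdn_leq // dvdn_lcm_denom // mem_cat xs ?orbT.
set n := (p * m0 + d.-1) %/ d.
have /andP[nd1 nd2] := ceil_div_bounds (p * m0) d0; rewrite -/n in nd1 nd2.
have np : n <= p.
  rewrite -ltnS -(ltn_pmul2r d0) (leq_trans nd2) // mulSn addnC leq_add2l.
  by rewrite leq_mul2l ltnW ?orbT.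
have ndp : n * d %/ p = m0.
  apply/eqP; rewrite eqn_leq leq_divRL ?prime_gt0 // [m0 * p]mulnC nd1 andbT.
  rewrite -ltnS ltn_divLR ?prime_gt0 // mulSn [m0 * p]mulnC addnC.
  by rewrite (ltn_trans nd2) // ltn_add2l.
have pc : p * c = 1 %[mod d] by rewrite -modnMml pc' modnMml mulnC.
have := (integral_rescaleP (fun a ha => param01 (Ha ha)) (fun b hb =>
  param01 (Hb hb)) c0n).1 hc0 p n pp.
rewrite val_c0 dval subrr mulr0 addr0 subr_ge0 lez_nat.
rewrite (eq_big_seq (fun b => class_count d c m0 (common_num d b))); last first.
  move=> b hb; apply: numval_class_count => //; last exact: Hb.
  by apply: dvdn_lcm_denom; rewrite mem_cat hb orbT.
move=> /leq_trans; apply; rewrite leq_eqVlt; apply/orP; left; apply/eqP.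
apply: eq_big_seq => a ha; apply: numval_class_count => //; last exact: Ha.
by apply: dvdn_lcm_denom; rewrite mem_cat ha.
Qed.

End Christol.

(** * Averaging over residue classes *)

Section TwistedCounts.
Variables (p f D n : nat).
Hypothesis pp : prime p.
Hypothesis pD : coprime p D.
Hypothesis D0 : 0 < D.

Let d := p ^ f * D.

(* [class_count] modulo [d] at a [c'] with [c' = c] mod [p ^ f] and [c' p ^ l = 1] mod [D]. *)
Definition twisted_count (c l m u : nat) : nat :=
  \sum_(1 <= j < m.+1) (j == c * u %[mod p ^ f]) * (p ^ l * j == u %[mod D]).

Lemma twisted_class_count c l : coprime c (p ^ f) ->
  exists2 c', coprime c' d & forall m u, class_count d c' m u = twisted_count c l m u.
Proof.
move=> cp; have plD : coprime (p ^ l) D by rewrite coprimeXl.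
have pfD : coprime (p ^ f) D by rewrite coprimeXl.
have [k pk] := mod_inverse D0 plD.
have kD : coprime k D.
  have : coprime (p ^ l * k) D by rewrite -coprime_modl pk coprime_modl coprime1n.
  by rewrite coprimeMl => /andP[].
set c' := chinese (p ^ f) D c k.
have c1 : c' = c %[mod p ^ f] by exact: chinese_modl.
have c2 : c' = k %[mod D] by exact: chinese_modr.
exists c'.
  rewrite coprimeMr; apply/andP; split; first by rewrite -coprime_modl c1 coprime_modl.
  by rewrite -coprime_modl c2 coprime_modl.
move=> m u; apply: eq_bigr => j _; rewrite mulnb; congr nat_of_bool.
rewrite chinese_remainder //; congr (_ && _).
  by rewrite -[in LHS]modnMml c1 modnMml.
rewrite -[in LHS]modnMml c2 modnMml; apply/eqP/eqP => e.
  by rewrite -modnMmr e modnMmr mulnA -modnMml pk modnMml mul1n.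
by rewrite -modnMmr -e modnMmr mulnA [k * _]mulnC -modnMml pk modnMml mul1n.
Qed.

Definition twisted_total (B u : nat) : nat :=
  \sum_(1 <= l < B.+1) \sum_(0 <= c < p ^ f | coprime c (p ^ f))
    twisted_count c l (n * d %/ p ^ l) u.

Let pX_gt0 l : 0 < p ^ l. Proof. by rewrite expn_gt0 prime_gt0. Qed.

Lemma sum_pfactor_class l g u :
  \sum_(1 <= j < (n * d %/ p ^ l).+1) (p ^ g %| j) * (p ^ l * j == u %[mod D]) =
  \sum_(1 <= i < (n * d).+1) (p ^ (l + g) %| i) * (i == u %[mod D]).
Proof.
rewrite (eq_bigr (fun j => (p ^ (l + g) %| p ^ l * j) * (p ^ l * j == u %[mod D]))).
  rewrite -(sum_multiples _ (fun i => (p ^ (l + g) %| i) * (i == u %[mod D]))) //.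
  apply: eq_bigr => i _; rewrite mulnA; congr (_ * _); rewrite mulnb; congr nat_of_bool.
  by apply: andb_idl => /(dvdn_trans _); apply; rewrite dvdn_exp2l // leq_addr.
by move=> j _; rewrite expnD dvdn_pmul2l.
Qed.

Lemma twisted_total_in B u : 0 < u <= d -> p ^ f %| u ->
  twisted_total B u =
  (\sum_(0 <= c < p ^ f) coprime c (p ^ f)) *
    \sum_(1 <= l < B.+1) \sum_(k < n) (p ^ (l + f) %| u + k * d).
Proof.
move=> ud pu; rewrite /twisted_total big_distrr /=; apply: eq_bigr => l _.
rewrite [in RHS]big_distrl /= big_mkcond; apply: eq_bigr => c _.
case: (coprime c _); last by rewrite mul0n.
rewrite mul1n -(sum_residue_class _ (fun i => p ^ (l + f) %| i)) //.
rewrite /twisted_count (eq_bigr (fun j => (p ^ f %| j) * (p ^ l * j == u %[mod D]))).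
  rewrite sum_pfactor_class; apply: eq_bigr => i _.
  rewrite mulnC !mulnb; congr nat_of_bool.
  rewrite [LHS]andbC [RHS]andbC; apply: andb_id2l => pi.
  rewrite chinese_remainder ?coprimeXl //; rewrite [_ == u %[mod p ^ f]](_ : _ = true) //.
  have pfi : p ^ f %| i by apply: dvdn_trans pi; rewrite dvdn_exp2l // leq_addl.
  by move: pfi pu; rewrite /dvdn => /eqP-> /eqP->.
move=> j _; congr (nat_of_bool _ * _); rewrite /dvdn.
have : p ^ f %| c * u by rewrite dvdn_mull.
by rewrite /dvdn => /eqP->.
Qed.

(* The sum over [l] telescopes, as [step] shows. *)
Lemma twisted_total_out B u : 0 < u -> logn p u < f -> n * d < p ^ B ->
  twisted_total B u = n * p ^ f.-1.
Proof.
move=> u0 gf nB; set g := logn p u in gf.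
have [w pw uE] := pfactor_coprime pp u0; rewrite -/g mulnC in uE.
have {}pw : ~~ (p %| w) by rewrite -prime_coprime.
pose I t := \sum_(1 <= i < (n * d).+1) (p ^ t %| i) * (i == u %[mod D]).
have step l : \sum_(0 <= c < p ^ f | coprime c (p ^ f)) twisted_count c l (n * d %/ p ^ l) u
   + p ^ g * I (l + g.+1) = p ^ g * I (l + g).
  rewrite /I -!sum_pfactor_class !big_distrr /twisted_count /= exchange_big /=.
  rewrite -big_split /=; apply: eq_bigr => j _.
  rewrite -big_distrl /= !mulnA -mulnDl; congr (_ * _).
  by have := count_pfactor_unit j pp pw gf; rewrite -uE.
have tele K : \sum_(1 <= l < K.+1) \sum_(0 <= c < p ^ f | coprime c (p ^ f))
    twisted_count c l (n * d %/ p ^ l) u + p ^ g * I (K.+1 + g) = p ^ g * I g.+1.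
  elim: K => [|K IH]; first by rewrite big_geq.
  rewrite big_nat_recr //= -IH -addnA; congr (_ + _).
  by rewrite -(step K.+1) addSnnS.
have IB : I (B.+1 + g) = 0.
  rewrite /I big_nat_cond big1 // => i /andP[/andP[i0 iN] _].
  case: (boolP (_ %| i)) => [/(dvdn_leq i0)|//]; rewrite leqNgt (leq_trans iN) //.
  by rewrite (leq_trans nB) // leq_exp2l ?prime_gt1 //; lia.
have := tele B; rewrite IB muln0 addn0 => tE; rewrite /twisted_total tE /I.
rewrite sum_multiples ?pX_gt0 //.
have ndE : n * d %/ p ^ g.+1 = n * p ^ (f - g.+1) * D.
  have -> : n * d = n * p ^ (f - g.+1) * D * p ^ g.+1.
    rewrite /d -{1}(subnKC gf) expnD.
    by move: (p ^ g.+1) (p ^ _) => x y; lia.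
  by rewrite mulnK ?pX_gt0.
rewrite ndE; rewrite (eq_bigr (fun k => nat_of_bool (u == k * p ^ g.+1 %[mod D]))).
  rewrite -add1n count_linear_from ?coprimeXl // mulnCA -expnD.
  by congr (_ * p ^ _); clear -gf; lia.
by move=> k _; rewrite eq_sym mulnC.
Qed.

End TwistedCounts.

Section SharpValuation.
Variables alpha beta : seq rat.
Hypothesis sz : size alpha = size beta.
Hypothesis Ha : {in alpha, forall a, 0 < a <= 1}%R.
Hypothesis Hb : {in beta, forall b, 0 < b <= 1}%R.
Hypothesis HF : N_integral (hypergeom alpha beta).

Let d := lcm_denom alpha beta.

Variables (p n : nat).
Hypothesis pp : prime p.

Let f := logn p d.

Lemma common_num_total D x : d = p ^ f * D -> coprime p D ->
  exact_denom x %| d -> (0 < x <= 1)%R ->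
  twisted_total p f D n (n * d) (common_num d x) =
  if in_Zp p x then (\sum_(0 <= c < p ^ f) coprime c (p ^ f)) * numval p x n
  else n * p ^ f.-1.
Proof.
move=> dE pD xd x01; have d0 : 0 < d := lcm_denom_gt0 alpha beta.
have D0 : 0 < D by move: d0; rewrite dE muln_gt0 => /andP[].
have [u0 ud] := andP (common_num_bounds d0 xd x01).
set u := common_num d x in u0 ud *.
case: ifP => [xZ|/negbT xZ]; last first.
  rewrite twisted_total_out //; last by rewrite -dE ltn_expl // prime_gt1.
  move: xZ; rewrite in_ZpE // negbK => pden.
  have pn : ~~ (p %| `|numq x|).
    apply/negP => pn; have := dvdn_gcd p `|numq x| `|denq x|; rewrite pn pden.
    have /eqP -> := coprime_num_den x.
    by rewrite dvdn1 (gtn_eqF (prime_gt1 pp)).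
  have n0 : 0 < `|numq x| by move: pn; case: `|numq x| => //; rewrite dvdn0.
  rewrite /u /common_num lognM ?cofactor_gt0 //.
  rewrite lognE pp n0 (negbTE pn) add0n /f -[X in _ < logn p X](divnK xd).
  rewrite lognM ?cofactor_gt0 ?exact_denom_gt0 // -[X in X < _]addn0 ltn_add2l.
  by rewrite logn_gt0 mem_primes pp exact_denom_gt0.
have lcof := logn_cofactor d0 xd pp xZ.
have cof0 := cofactor_gt0 d0 xd.
have pu : p ^ f %| u by rewrite /u /common_num pfactor_dvdn // lognM ?lcof ?leq_addl //;
  move: u0; rewrite /u /common_num muln_gt0 => /andP[].
rewrite twisted_total_in -?dE ?u0 //; congr (_ * _).
rewrite exchange_big /=; apply: eq_bigr => k _.
have m0 := num_shift_gt0 d0 xd x01 k; have sE := common_num_shift d0 xd x01 k.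
set m1 := `|_| in m0 sE *.
rewrite (@logn_sum p m1 (n * d)) //.
  apply: eq_bigr => l _; rewrite sE; congr nat_of_bool.
  rewrite !pfactor_dvdn ?muln_gt0 ?cof0 // lognM // lcof -/f.
  by rewrite addnC leq_add2l.
apply: ltnW; apply: (leq_trans (ltn_expl _ (prime_gt1 pp))).
apply: (leq_trans (dvdn_leq m0 (pfactor_dvdnn p _))).
apply: (@leq_trans (u + k * d)); first by rewrite sE leq_pmull.
apply: (@leq_trans (k.+1 * d)); first by rewrite mulSn leq_add2r.
by rewrite leq_mul2r ltn_ord orbT.
Qed.

Lemma sum_common_total D (t : seq rat) : d = p ^ f * D -> coprime p D ->
  {in t, forall x, exact_denom x %| d} -> {in t, forall x, 0 < x <= 1}%R ->
  \sum_(x <- t) twisted_total p f D n (n * d) (common_num d x) =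
  (\sum_(0 <= c < p ^ f) coprime c (p ^ f)) * (\sum_(x <- t) numval p x n)
  + (size t - count (in_Zp p) t) * (n * p ^ f.-1).
Proof.
move=> dE pD; elim: t => [|x t IH] hd h01; first by rewrite !big_nil muln0.
have xt : x \in x :: t by rewrite inE eqxx.
have yt y : y \in t -> y \in x :: t by rewrite inE orbC => ->.
rewrite !big_cons IH; [|by move=> y /yt; exact: hd|by move=> y /yt; exact: h01].
rewrite common_num_total ?hd ?h01 //= mulnDr.
have := count_size (in_Zp p) t; case: (boolP (in_Zp p x)) => xZ ct.
  by rewrite add1n subSS addnA.
by rewrite add0n numval_notin // muln0 add0n subSn // mulSn addnCA.
Qed.

Lemma numval_sharp :
  (n%:Z * Num.floor ((lambda p alpha beta)%:~R / (p%:R - 1) : rat) <=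
   (\sum_(a <- alpha) numval p a n)%N%:Z - (\sum_(b <- beta) numval p b n)%N%:Z)%R.
Proof.
have d0 : 0 < d := lcm_denom_gt0 alpha beta.
have [D pD dE] := pfactor_coprime pp d0; rewrite -/f mulnC in dE.
have D0 : 0 < D by move: d0; rewrite dE muln_gt0 => /andP[].
have ineq : \sum_(b <- beta) twisted_total p f D n (n * d) (common_num d b) <=
            \sum_(a <- alpha) twisted_total p f D n (n * d) (common_num d a).
  rewrite /twisted_total exchange_big [X in _ <= X]exchange_big /=; apply: leq_sum => l _.
  rewrite exchange_big [X in _ <= X]exchange_big /=; apply: leq_sum => c cp.
  have [c' c'd cE] := twisted_class_count pD D0 l cp.
  rewrite -dE in c'd; have := christol sz Ha Hb HF (n * (p ^ f * D) %/ p ^ l) c'd.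
  rewrite -/d dE.
  do 2![rewrite (eq_bigr _ (fun x _ => cE _ _))].
  by [].
have da x : x \in alpha -> exact_denom x %| d by move=> xs; apply: dvdn_lcm_denom;
  rewrite mem_cat xs.
have db x : x \in beta -> exact_denom x %| d by move=> xs; apply: dvdn_lcm_denom;
  rewrite mem_cat xs orbT.
rewrite !(sum_common_total dE pD) // in ineq.
have p1 := prime_gt1 pp.
have p1r : (0 < p%:R - 1 :> rat)%R by rewrite subr_gt0 ltr1n.
set F := Num.floor _; set l := lambda p alpha beta in F *.
have Fl : (F * (p%:Z - 1) <= l)%R.
  have FE : ((F * (p%:Z - 1))%:~R = F%:~R * (p%:R - 1) :> rat)%R by rewrite intrM intrB -pmulrn.
  have := floor_le (l%:~R / (p%:R - 1) : rat)%R; rewrite -/F ler_pdivlMr //.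
  by rewrite -(ler_int rat) FE.
have ca := count_size (in_Zp p) alpha; have cb := count_size (in_Zp p) beta.
have phiE : 0 < f -> \sum_(0 <= c < p ^ f) coprime c (p ^ f) = p.-1 * p ^ f.-1.
  move=> f0; rewrite -totient_pfactor // totient_count_coprime.
  by apply: eq_bigr => c _; rewrite coprime_sym.
have [f0|f0] := posnP f.
  have ZpA t : {in t, forall x, exact_denom x %| d} -> count (in_Zp p) t = size t.
    move=> h; apply/eqP; rewrite -all_count; apply/allP => x xt; rewrite in_ZpE //.
    have pnd : ~~ (p %| d) by move/eqP: f0; rewrite /f -leqn0 leqNgt logn_gt0 mem_primes pp d0.
    by apply: contra pnd => /dvdn_trans; apply; exact: h.
  have l0 : l = 0%R by rewrite /l /lambda !ZpA // sz subrr.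
  have F0 : F = 0%R by rewrite /F l0 mul0r floor0.
  rewrite F0 mulr0 subr_ge0 lez_nat; move: ineq.
  by rewrite f0 expn0 big_nat1 coprimen1 !mul1n !ZpA // !subnn !mul0n !addn0.
have ppos : 0 < p ^ f.-1 by rewrite expn_gt0 prime_gt0.
have factor S c : p.-1 * p ^ f.-1 * S + c * (n * p ^ f.-1) = p ^ f.-1 * (p.-1 * S + c * n).
  by move: (p ^ f.-1) (p.-1) => X q; lia.
rewrite (phiE f0) !factor leq_pmul2l // sz in ineq.
have p1z : (0 < p%:Z - 1)%R by lia.
rewrite -(ler_pM2r p1z) -mulrA.
apply: (@le_trans _ _ (n%:Z * l)%R); first by rewrite ler_wpM2l.
move: ca cb ineq; rewrite sz /l /lambda; clear -p1.
move: (\sum_(a <- alpha) _) (\sum_(b <- beta) _) (count _ alpha) (count _ beta) (size beta).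
move=> Sa Sb ca cb t cat cbt.
have pE : (p.-1%:Z = p%:Z - 1)%R by lia.
rewrite -lez_nat !PoszD !PoszM pE -!subzn //; nia.
Qed.

End SharpValuation.

End NaturalCounts.

(** * The constant *)

Definition predicted_const (alpha beta : seq rat) : rat :=
  ((\prod_(a <- alpha) (exact_denom a)%:R)
     / (\prod_(b <- beta) (exact_denom b)%:R))
  * \prod_(p <- exc_primes alpha beta)
      p%:R ^ (- Num.floor ((lambda p alpha beta)%:~R / (p%:R - 1) : rat)).

Lemma exc_prime_prime alpha beta p : p \in exc_primes alpha beta -> prime p.
Proof. by rewrite mem_exc_primes => /andP[]. Qed.

Lemma predicted_const_gt0 alpha beta : 0 < predicted_const alpha beta.
Proof.
rewrite /predicted_const mulr_gt0 ?divr_gt0 //; try by apply: prodr_gt0 => x _;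
  rewrite ltr0n exact_denom_gt0.
rewrite big_seq; apply: prodr_gt0 => p /exc_prime_prime pp.
by rewrite exprz_gt0 // ltr0n prime_gt0.
Qed.

Lemma padic_val_prod_denom p (s : seq rat) :
  padic_val p (\prod_(x <- s) (exact_denom x)%:R) =
  (\sum_(x <- s) logn p (exact_denom x))%N%:Z.
Proof.
rewrite padic_val_prod => [|x _]; last by rewrite pnatr_eq0 -lt0n exact_denom_gt0.
rewrite (eq_bigr (fun x => (logn p (exact_denom x))%:Z)) => [|x _]; last exact: padic_val_nat.
by rewrite (big_morph Posz PoszD (erefl _)).
Qed.

Lemma padic_val_predicted_const alpha beta p : prime p ->
  padic_val p (predicted_const alpha beta) = denom_val alpha beta p +
    (if exc_prime alpha beta p then
       - Num.floor ((lambda p alpha beta)%:~R / (p%:R - 1) : rat) else 0).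
Proof.
move=> pp.
have prod0 (s : seq rat) : \prod_(x <- s) ((exact_denom x)%:R : rat) != 0.
  by rewrite prodf_seq_neq0; apply/allP => x _; rewrite /= pnatr_eq0 -lt0n exact_denom_gt0.
have q0 q : q \in exc_primes alpha beta -> (q%:R : rat) != 0.
  by move=> /exc_prime_prime qp; rewrite pnatr_eq0 -lt0n prime_gt0.
have exc0 : {in exc_primes alpha beta, forall q : nat,
    (q%:R : rat) ^ (- Num.floor ((lambda q alpha beta)%:~R / (q%:R - 1) : rat)) != 0}.
  by move=> q /q0 qn; rewrite expfz_neq0.
rewrite /predicted_const padic_valM; last first.
- by rewrite prodf_seq_neq0; apply/allP.
- by rewrite mulf_neq0 ?invr_eq0.
rewrite padic_valM ?invr_eq0 // padic_valV // !padic_val_prod_denom; congr (_ + _).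
rewrite padic_val_prod //.
have term q : q \in exc_primes alpha beta ->
    padic_val p ((q%:R : rat) ^ (- Num.floor ((lambda q alpha beta)%:~R / (q%:R - 1) : rat))) =
    if q == p then - Num.floor ((lambda p alpha beta)%:~R / (p%:R - 1) : rat) else 0.
  move=> qe; rewrite padic_valXz ?q0 // padic_val_nat logn_prime ?(exc_prime_prime qe) //.
  by rewrite eq_sym; case: eqP => [->|_]; rewrite ?mul1r ?mul0r.
rewrite (eq_big_seq _ term) -mem_exc_primes.
case: ifP => [pe|pe]; last first.
  by rewrite big_seq big1 // => q qe; case: eqP => // qp; rewrite -qp qe in pe.
rewrite (big_rem _ pe) /= eqxx big_seq big1 ?addr0 // => q.
rewrite mem_rem_uniq ?exc_primes_uniq // inE => /andP[/negbTE -> _] //.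
Qed.

Lemma not_exc_prime alpha beta p : prime p -> ~~ exc_prime alpha beta p ->
  [/\ denom_val alpha beta p = 0,
      lambda p alpha beta = (size alpha)%:Z - (size beta)%:Z
    & (size alpha + 1 < p + size beta)%N].
Proof.
move=> pp; rewrite /exc_prime pp /= negb_or -ltnNge => /andP[pd lt]; split=> //.
- have l0 x : x \in alpha ++ beta -> logn p (exact_denom x) = 0%N.
    move=> xs; apply/eqP; rewrite -leqn0 leqNgt logn_gt0 mem_primes;
      apply/negP => /and3P[_ _ px].
    by move/negP: pd; apply; apply: dvdn_trans px _; exact: dvdn_lcm_denom.
  rewrite /denom_val !big_seq !big1 // => x xs; apply: l0; rewrite mem_cat xs ?orbT //.
- have inZ x : x \in alpha ++ beta -> in_Zp p x.
    move=> xs; rewrite in_ZpE //; apply: contra pd => /dvdn_trans; apply.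
    exact: dvdn_lcm_denom.
  rewrite /lambda; congr (_%:Z - _%:Z); apply/eqP; rewrite -all_count; apply/allP => x xs;
  by apply: inZ; rewrite mem_cat xs ?orbT.
Qed.

Theorem theorem1 (r s : nat) (alpha : r.-tuple rat) (beta : s.-tuple rat)
    (Halpha : {in alpha, forall a, is_param a})
    (Hbeta : {in beta, forall b, is_param b})
    (HF : N_integral (hypergeom alpha beta)) :
  exists2 Cab : rat, is_eisenstein_const (hypergeom alpha beta) Cab &
  exists C : nat,
    Cab = C%:R
          * ((\prod_(a <- alpha) (exact_denom a)%:R)
             / (\prod_(b <- beta) (exact_denom b)%:R))
          * \prod_(p <- exc_primes alpha beta)
              p%:R ^ (- Num.floor ((lambda p alpha beta)%:~R / (p%:R - 1) : rat))
    /\ (r = s ->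
        {in alpha, forall a, 0 < a <= 1} ->
        {in beta, forall b, 0 < b <= 1} ->
        C = 1%N).
Proof.
have f1 := hypergeom_neq0 Halpha Hbeta 1.
have [Cab CabP] := eisenstein_const_exists f1 HF; exists Cab => //.
have [Cab0 Cabgen] := CabP.
set E := predicted_const alpha beta; have E0 : 0 < E by exact: predicted_const_gt0.
have Cab_int : integral_series (rescale Cab (hypergeom alpha beta)).
  by apply/Cabgen; exists 1; rewrite mulr1.
have Cabn0 : Cab != 0 by rewrite gt_eqF.
have En0 : E != 0 by rewrite gt_eqF.
have ratio_int : Cab / E \is a Num.int.
  apply: int_of_padic_val => p pp.
  rewrite padic_valM ?invr_eq0 // padic_valV // subr_ge0 padic_val_predicted_const //.
  have growth := (integral_rescaleP Halpha Hbeta Cabn0).1 Cab_int p ^~ pp.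
  have := floor_le_of_growth Halpha Hbeta pp growth.
  case: ifP => [_|/negbT/(not_exc_prime pp)[dv lE lt]].
    by rewrite lerBrDl.
  rewrite dv lE addr0 subr0; apply: le_trans; rewrite oppr_ge0 floor_le0.
  have p1r : 0 < p%:R - 1 :> rat by rewrite subr_gt0 ltr1n prime_gt1.
  rewrite ltr_pdivrMr // mul1r.
  have -> : p%:R - 1 = (p%:Z - 1)%:~R :> rat by rewrite intrB -pmulrn.
  by rewrite ltr_int; lia.
have [C CE] : exists C : nat, Cab = C%:R * E.
  have : `|Cab / E| \is a Num.nat by rewrite natr_norm_int.
  rewrite gtr0_norm ?divr_gt0 // => /natrP[C CE]; exists C.
  by rewrite -CE divfK.
exists C; split; first by rewrite CE /E /predicted_const [LHS]mulrA.
move=> rs a01 b01.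
have sz : size alpha = size beta by rewrite !size_tuple.
have [k Ek] : exists k : int, E = Cab * k%:~R.
  apply/Cabgen; apply/(integral_rescaleP Halpha Hbeta En0) => p n pp.
  have := numval_sharp sz a01 b01 HF n pp.
  rewrite padic_val_predicted_const // [denom_val _ _ _ + _]addrC addrK.
  case: ifP => [_|/negbT/(not_exc_prime pp)[_ lE _]].
    by rewrite mulrN subr_ge0.
  by rewrite lE sz subrr mul0r floor0 !mulr0 addr0.
have : C%:Z * k = 1.
  apply/eqP; rewrite -(eqr_int rat) intrM -pmulrn.
  rewrite -(inj_eq (mulIf En0)) mul1r mulrAC -CE -Ek //.
by clear; case: C => [|[|C]] //; case: k => [[|[|k]]|k]; lia.
Qed.
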